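(* For every $n\ge 1$ the genus distribution of the cross $R_n$ is unimodal, and its peak $p_R(n)$ is $$p_R(n)=\begin{cases}\Big[\dfrac{n+1}{2}\Big], & 1\le n\le 6,\\[2mm] 3, & n=7,\\[1mm] \Big[\dfrac{n+2}{3}\Big]+1, & n\ge 8.\end{cases}$$
   Context: $[x]$ denotes the largest integer not exceeding $x$. The cross $R_n$ is the cubic multigraph consisting of a cycle of length $2n+2$ whose vertices in cyclic order are $w,u_1,u_2,\dots,u_n,v_n,v_{n-1},\dots,v_1,w'$, together with the edges $u_lv_{n-l+1}$ for $1\le l\le n$ and one additional edge joining $w$ and $w'$ (so $w,w'$ are joined by two parallel edges). For a graph $G$, $g_i(G)$ is the number of 2-cell embeddings of $G$ on the orientable surface of genus $i$ (embeddings counted as rotation systems), and the genus distribution of $G$ is the sequence $g_\gamma(G),g_{\gamma+1}(G),\dots,g_{\gamma_M}(G)$ with $\gamma,\gamma_M$ the minimum and maximum genus of $G$. A finite sequence of nonnegative numbers $\{a_i\}_{i=q}^n$ is unimodal if $a_q\le\cdots\le a_{l-1}<a_l=\cdots=a_m>a_{m+1}\ge\cdots\ge a_n$ for some $q\le l\le m\le n$; if $l=m$, then $m$ is called the peak (indices are genera). *)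

(* Defs.v *)
From mathcomp Require Import all_boot all_fingroup.
Set Implicit Arguments.
Unset Strict Implicit.
Unset Printing Implicit Defensive.

(* Loops and parallel edges are allowed; the order of the two ends of an edge
   only serves to name its two half-edges. *)
Record multigraph := Multigraph {
  vertex : finType;
  edge : finType;
  ends : edge -> vertex * vertex
}.

Section Embeddings.
Variable G : multigraph.

(* (e, false) leaves (ends e).1 and (e, true) leaves (ends e).2. *)
Definition dart : finType := (edge G * bool)%type.

Definition tail (d : dart) : vertex G :=
  if d.2 then (ends d.1).2 else (ends d.1).1.

Definition reverse_dart (d : dart) : dart := (d.1, ~~ d.2).

Lemma reverse_dartK : involutive reverse_dart.
Proof. by case=> e b; rewrite /reverse_dart negbK. Qed.

Definition flip : {perm dart} := perm (inv_inj reverse_dartK).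

(* At each vertex the permutation cycles once through all darts leaving it. *)
Definition is_rotation_system (s : {perm dart}) : bool :=
  [forall d, porbit s d == [set d' | tail d' == tail d]].

Definition rotation_systems : {set {perm dart}} :=
  [set s | is_rotation_system s].

(* Permutations compose from left to right: after d, a face boundary continues
   with s (reverse_dart d). *)
Definition faces (s : {perm dart}) : {set {set dart}} :=
  porbits (flip * s)%g.

(* Solution i of Euler's formula #|V| - #|E| + #|F| = 2 - 2i. If G is connected
   with at least one edge, then the faces of the 2-cell embedding given by s
   correspond to the elements of faces s, and neither the subtraction nor the
   halving truncates. *)
Definition genus (s : {perm dart}) : nat :=
  ((#|edge G| + 2) - (#|vertex G| + #|faces s|))./2.

Definition embeddings_of_genus (i : nat) : nat :=
  #|[set s in rotation_systems | genus s == i]|.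

Definition max_genus : nat := \max_(s in rotation_systems) genus s.

(* The default value max_genus does not lower the minimum. *)
Definition min_genus : nat :=
  \big[minn/max_genus]_(s in rotation_systems) genus s.

End Embeddings.

(* a_q <= ... <= a_(l-1) < a_l = ... = a_m > a_(m+1) >= ... >= a_n *)
Definition unimodal_with_plateau (a : nat -> nat) (q n l m : nat) : Prop :=
  [/\ q <= l <= m, m <= n &
  [/\ forall i, q <= i -> i.+1 < l -> a i <= a i.+1,
      q < l -> a l.-1 < a l,
      forall i, l <= i <= m -> a i = a l,
      m < n -> a m.+1 < a m &
      forall i, m < i -> i < n -> a i.+1 <= a i]].

Definition unimodal (a : nat -> nat) (q n : nat) : Prop :=
  exists l m, unimodal_with_plateau a q n l m.

Definition is_peak (a : nat -> nat) (q n p : nat) : Prop :=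
  unimodal_with_plateau a q n p p.

Section Cross.
Variable n : nat.

(* Positions along the Hamiltonian cycle
   w, u_1, ..., u_n, v_n, ..., v_1, w'. *)
Definition cross_vertex : finType := 'I_(2 * n).+2.

Definition cross_w : cross_vertex := ord0.
Definition cross_u (l : nat) : cross_vertex := inord l.
Definition cross_v (l : nat) : cross_vertex := inord ((2 * n).+1 - l).
Definition cross_w' : cross_vertex := ord_max.

(* The edges of the cycle, the edges u_l v_(n-l+1), and the second edge between
   w and w'. *)
Definition cross_edge : finType := (cross_vertex + 'I_n + unit)%type.

(* The index k : 'I_n stands for l = k + 1. *)
Definition cross_ends (e : cross_edge) : cross_vertex * cross_vertex :=
  match e with
  | inl (inl i) => (i, ordS i)
  | inl (inr k) => let l := k.+1 in (cross_u l, cross_v (n - l + 1))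
  | inr _ => (cross_w, cross_w')
  end.

Definition cross : multigraph := Multigraph cross_ends.

End Cross.

Definition cross_peak (n : nat) : nat :=
  if n <= 6 then (n + 1) %/ 2
  else if n == 7 then 3
  else (n + 2) %/ 3 + 1.

(* Main.v *)
(* Adding the rungs of R_n one at a time, the faces of the part already built matter only
   through the order in which they meet its four open half-edges: a permutation of four
   points. Each gluing of two half-edges multiplies the face permutation by a
   transposition, hence splits a face or merges two, so that the genus distribution is
   computed by a transfer matrix on 24 states. Its nontrivial eigenvalues satisfy
   x^2 = 4z, x^2 = x + 8z and x^2 = 2x + 8z, which gives g_i(R_n) in closed form; with
   m = n - 1 and j = i - 1 the dominant terms are multiples of
   2 ^ (m - 2j) 8 ^ j C(m - j, j), and the others lack the factor 2 ^ (m - 2j). Put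
   b = m - 2j. For n >= 8 the difference g_(j+2) - g_(j+1) has the sign of a polynomial in
   2 ^ b, b and j, positive for b >= j and negative for b < j; and b >= j means
   3j <= n - 1, which locates the peak. *)
From Stdlib Require Import ZArith Lia.
Require Import Defs.
From mathcomp Require Import all_boot all_order all_fingroup all_algebra.
From mathcomp Require Import zify ssrZ.
(* The Stdlib tactic, which the next import shadows. *)
Ltac Z_ring := ring.
From mathcomp Require Import ring.
Set Implicit Arguments.
Unset Strict Implicit.
Unset Printing Implicit Defensive.
Import Order.TTheory GRing.Theory Num.Theory.

(** * Gluing half-edges *)

(** Gluing starts from the disjoint stars of the vertices, one face each. After E gluings, M of them
    merging, F = V + E - 2M, and Euler's formula gives genus M - (V - 1): the genus counts merges,
    apart from the V - 1 that connectivity forces.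

    The obstacle is that faces are orbits of one global permutation, whereas a merge has to be
    decided from a few open darts. Hence the statements with an arbitrary permutation [t], which
    stands for the edges not yet glued: glued darts are excised, and the error that this makes in
    the orbit count does not depend on [t].

    The sign of the differences involves 2 ^ b. Where its cofactor has a known sign, 2 ^ b is
    replaced by a linear lower bound, and shifting b and j to the corner of the region gives all
    coefficients the same sign. For n = 7 the pair b = j = 2 satisfies b >= j although the
    difference is negative, which is why the general rule starts at 8. *)

Section Gluing.
Variable D : finType.
Implicit Types (s t : {perm D}) (x y z : D) (ps : seq D) (f lv : seq nat).

(* The cycle through x with x taken out: x becomes a fixed point. *)
Definition excise x s : {perm D} := (tperm x ((s^-1)%g x) * s)%g.

Lemma exciseE x s z :
  excise x s z = if z == x then x else if s z == x then s x else s z.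
Proof.
rewrite permM; case: tpermP => [->|->|/eqP/negbTE zx /eqP zy].
- by rewrite eqxx permKV.
- by rewrite permKV eqxx; case: eqP => // {1}<-; rewrite permKV.
rewrite zx; case: eqP => // szx; case/negP: zy.
by rewrite -szx permK.
Qed.

(** Since [t] fixes x, bypassing x in [s] is the same as bypassing it in [u = t * s]: a
    transposition cuts x out of its own orbit, which yields one orbit more unless x was already
    fixed. The surplus depends on [s] alone. *)
Lemma card_porbits_excise s t x : t x = x ->
  #|porbits (t * excise x s)%g| = #|porbits (t * s)%g| + (s x != x).
Proof.
move=> tx; set u := (t * s)%g; have ux : u x = s x by rewrite permM tx.
have tVx : t^-1%g x = x by rewrite -{1}tx permK.
have -> : (t * excise x s = tperm x (u^-1 x) * u)%g.
  have tC y : (t * tperm x y = tperm x (t^-1 y) * t)%g.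
    by rewrite (conjgCV t) tpermJ tVx.
  by rewrite /excise mulgA tC -mulgA invMg permM.
have := porbits_mul_tperm u x (u^-1 x)%g.
have -> : x \in porbit u (u^-1 x)%g.
  by rewrite -{1}(permKV u x) -[u _]/((u ^+ 1)%g _) mem_porbit.
rewrite /= addn0 => ->; congr (_ + ~~ _).
by rewrite -ux (can2_eq (permK _) (permKV _)).
Qed.

(** The surplus from excising x and y is the same for [t] and for the identity; comparing the two
    eliminates it and leaves the split or merge caused by the transposition. [skip] is applied twice
    because a walk that meets x continues at s y, which may be y itself; injectivity of [s] excludes
    a third detour. *)
Lemma glue_porbits s x y : x != y -> exists s' : {perm D},
  [/\ forall t, t x = x -> t y = y ->
        #|porbits (t * (tperm x y * s))%g| + #|porbits s'|
          + (x \notin porbit s y).*2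
        = #|porbits (t * s')%g| + #|porbits s|.+1
    & forall z, z != x -> z != y ->
        let skip w := if w == x then s y else if w == y then s x else w in
        s' z = skip (skip (s z))].
Proof.
move=> xy; set u := (tperm x y * s)%g.
have ux : u x = s y by rewrite permM tpermL.
have uy : u y = s x by rewrite permM tpermR.
exists (excise y (excise x u)); split=> [t tx ty | z zx zy /=].
  rewrite card_porbits_excise // card_porbits_excise //.
  have := card_porbits_excise (excise x u) (perm1 y).
  have := card_porbits_excise u (perm1 x).
  have := porbits_mul_tperm s x y.
  rewrite !mul1g xy /= -/u; lia.
have uz : u z = s z by rewrite permM tpermD // eq_sym.
rewrite !exciseE (negbTE zy) (negbTE zx) uz ux uy [y == x]eq_sym (negbTE xy).
have sxz : s x != s z by rewrite (inj_eq perm_inj) eq_sym.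
have syz : s y != s z by rewrite (inj_eq perm_inj) eq_sym.
case: (eqVneq (s z) x) => [szx | szx].
  by move: sxz syz; rewrite szx => /negbTE -> /negbTE ->.
case: (eqVneq (s z) y) => [szy | szy]; last by rewrite (negbTE szx) (negbTE szy).
by move: sxz; rewrite szy => /negbTE ->.
Qed.

(* The index [i] stands for the dart [nth x0 ps i], and [f] for the permutation of the
   live indices [lv] induced by [s]; the other entries of [f] are junk. *)
Definition represents x0 ps lv f s :=
  forall i, i \in lv -> s (nth x0 ps i) = nth x0 ps (nth 0 f i).

Definition glue i j f :=
  let skip w := if w == i then nth 0 f j else if w == j then nth 0 f i else w in
  [seq skip (skip w) | w <- f].

Definition remove i j lv := [seq k <- lv | (k != i) && (k != j)].

Definition orbit_of f j := traject (nth 0 f) j (size f).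

(* The last conjunct certifies that [orbit_of f j] is a whole orbit. *)
Definition gluable i j lv f :=
  [&& i != j, i \in lv, j \in lv, all (fun k => nth 0 f k \in lv) lv,
      0 < size f,
      all (fun k => k < size f) lv
    & all (fun k => (k \in lv) && (nth 0 f k \in orbit_of f j)) (orbit_of f j)].

(* The number returned last counts the gluings that merge two faces. *)
Fixpoint glue_all (es : seq (nat * nat)) lv f : seq nat * seq nat * nat :=
  if es is (i, j) :: es' then
    let: (lv', f', m) := glue_all es' (remove i j lv) (glue i j f) in
    (lv', f', (i \notin orbit_of f j) + m)
  else (lv, f, 0).

Fixpoint gluable_all (es : seq (nat * nat)) lv f :=
  if es is (i, j) :: es' then
    gluable i j lv f && gluable_all es' (remove i j lv) (glue i j f)
  else true.

(** The head of the list becomes the rightmost factor, adjacent to [s] in [tperms x0 ps es * s], so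
    that it is the first edge to be glued. *)
Definition tperms x0 ps (es : seq (nat * nat)) : {perm D} :=
  foldr (fun e t => t * tperm (nth x0 ps e.1) (nth x0 ps e.2))%g 1%g es.

Lemma mem_porbit_represents x0 ps lv f s i j :
    uniq ps -> all (fun k => k < size ps) lv -> represents x0 ps lv f s ->
    gluable i j lv f ->
  (nth x0 ps i \in porbit s (nth x0 ps j)) = (i \in orbit_of f j).
Proof.
move=> ups /allP ltlv rep /and5P[ij ilv jlv /allP stab /and3P[f0 _ /allP orb]].
have jorb : j \in orbit_of f j.
  by rewrite /orbit_of; case: (size f) f0 => // n _; rewrite inE eqxx.
have iterE n : (s ^+ n)%g (nth x0 ps j) = nth x0 ps (iter n (nth 0 f) j)
    /\ iter n (nth 0 f) j \in orbit_of f j.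
  elim: n => [|n [IH1 IH2]]; first by rewrite expg0 perm1.
  have /andP[lvn orbn] := orb _ IH2.
  by rewrite expgSr permM IH1 rep.
apply/porbitP/trajectP => [[n] | [n ltn ->]]; last by exists n; case: (iterE n).
have [-> iorb] := iterE n => /eqP.
have /andP[klv _] := orb _ iorb.
rewrite nth_uniq ?ltlv // => /eqP ->; exact/trajectP.
Qed.

Lemma tperms_fix x0 ps es lv f k :
    uniq ps -> all (fun i => i < size ps) lv -> gluable_all es lv f ->
    k < size ps -> k \notin lv ->
  tperms x0 ps es (nth x0 ps k) = nth x0 ps k.
Proof.
move=> ups; elim: es lv f => [|[i j] es IH] lv f /=; first by rewrite perm1.
move=> ltlv /andP[/and4P[ij ilv jlv _] ok] ltk klv.
have ltlv1 : all (fun k => k < size ps) (remove i j lv).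
  by apply/allP=> i1; rewrite mem_filter => /andP[_ /(allP ltlv)].
rewrite permM (IH _ _ ltlv1 ok) ?mem_filter ?(negbTE klv) ?andbF //=.
have neq k1 : k1 \in lv -> nth x0 ps k1 != nth x0 ps k.
  move=> k1lv; have ltk1 := allP ltlv _ k1lv; rewrite nth_uniq //.
  by apply: contraTneq k1lv => ->.
by rewrite tpermD ?neq.
Qed.

(** Iterates [glue_porbits] with the product of [t] and the later transpositions in the role of [t];
    that product fixes the two darts of the current edge by [tperms_fix]. The clause about points
    outside [ps] says that vertices not yet reached keep their rotation. *)
Lemma glue_all_porbits x0 ps es lv f s :
    uniq ps -> all (fun k => k < size ps) lv ->
    represents x0 ps lv f s -> gluable_all es lv f ->
  let: (lv', f', m) := glue_all es lv f in
  exists s' : {perm D},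
  [/\ represents x0 ps lv' f' s',
      forall z, z \notin ps -> s z \notin ps -> s' z = s z
    & forall t, (forall e, e \in es ->
          t (nth x0 ps e.1) = nth x0 ps e.1 /\ t (nth x0 ps e.2) = nth x0 ps e.2) ->
        #|porbits (t * (tperms x0 ps es * s))%g| + #|porbits s'| + m.*2
        = #|porbits (t * s')%g| + #|porbits s| + size es].
Proof.
move=> ups; elim: es lv f s => [|[i j] es IH] lv f s /= ltlv rep.
  move=> _; exists s; split=> // t _; rewrite mul1g; lia.
move=> /andP[okij ok]; have /and5P[ij ilv jlv /allP stab /and3P[_ /allP ltf _]] := okij.
have [lti ltj] := (allP ltlv _ ilv, allP ltlv _ jlv).
have xy : nth x0 ps i != nth x0 ps j by rewrite nth_uniq.
have [s1 [cnt1 s1E]] := glue_porbits s xy.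
have ltlv1 : all (fun k => k < size ps) (remove i j lv).
  by apply/allP=> k; rewrite mem_filter => /andP[_ /(allP ltlv)].
have rep1 : represents x0 ps (remove i j lv) (glue i j f) s1.
  move=> k; rewrite mem_filter => /andP[/andP[ki kj] klv].
  have ltk := allP ltlv _ klv.
  rewrite s1E ?nth_uniq // rep // (nth_map 0) ?ltf //=.
  have skE w : w \in lv -> (if nth x0 ps w == nth x0 ps i then s (nth x0 ps j)
      else if nth x0 ps w == nth x0 ps j then s (nth x0 ps i) else nth x0 ps w)
    = nth x0 ps (if w == i then nth 0 f j else if w == j then nth 0 f i else w).
    move=> wlv; rewrite !nth_uniq ?(allP ltlv) // !rep //.
    by case: ifP => // _; case: ifP.
  rewrite !skE ?stab //; case: ifP => _; rewrite ?stab //.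
  by case: ifP => _; rewrite ?stab.
have /= := IH _ _ _ ltlv1 rep1 ok.
case: (glue_all es _ _) => [[lv' f'] m] [s2 [rep2 frame2 cnt2]].
exists s2; split=> // [z zps szps | t tfix].
  have zn k : k < size ps -> z != nth x0 ps k.
    by move=> ltk; apply: contraNneq zps => ->; apply: mem_nth.
  have szn k : k < size ps -> s z != nth x0 ps k.
    by move=> ltk; apply: contraNneq szps => ->; apply: mem_nth.
  have s1z : s1 z = s z.
    by rewrite s1E ?zn //= !(negbTE (szn _ _)) // !(negbTE (szn _ _)).
  by rewrite frame2 ?s1z.
have [ti tj] := tfix (i, j) (mem_head _ _).
have fixij k : (k == i) || (k == j) -> k < size ps ->
    (t * tperms x0 ps es)%g (nth x0 ps k) = nth x0 ps k.
  move=> kij ltk; rewrite permM.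
  have -> : t (nth x0 ps k) = nth x0 ps k by case/orP: kij => /eqP ->.
  apply: (tperms_fix _ ups ltlv1 ok) => //.
  by rewrite mem_filter -negb_or kij.
have tfix2 e : e \in es ->
    t (nth x0 ps e.1) = nth x0 ps e.1 /\ t (nth x0 ps e.2) = nth x0 ps e.2.
  by move=> ees; apply: tfix; rewrite inE ees orbT.
have := cnt1 _ (fixij i _ lti) (fixij j _ ltj); rewrite !eqxx orbT.
move=> /(_ erefl erefl).
have := cnt2 t tfix2.
rewrite (mem_porbit_represents ups ltlv rep okij) !mulgA doubleD.
by move: (#|_|) (#|_|) (#|_|) (#|_|) (#|_|) (_.*2) (_.*2) => *; lia.
Qed.

End Gluing.

(** * Darts and rotation systems of the cross *)

Section CrossDarts.
Variable m : nat.
Local Notation n := m.+1.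
Local Notation D := (dart (cross n)).

(* The darts at position p of the Hamiltonian cycle: slot 0 points to position p - 1,
   slot 2 to position p + 1, and slot 1 along the edge off the cycle. *)
Definition port (p k : nat) : D :=
  match k with
  | 0 => (inl (inl (inord (if p == 0 then (2 * n).+1 else p.-1))), true)
  | 1 => if p == 0 then (inr tt, false)
         else if p <= n then (inl (inr (inord p.-1)), false)
         else if p <= 2 * n then (inl (inr (inord (p - n.+1))), true)
         else (inr tt, true)
  | _ => (inl (inl (inord p)), false)
  end.

Arguments port : simpl never.

Definition slot (d : D) : nat :=
  match d.1 with inl (inl _) => if d.2 then 0 else 2 | _ => 1 end.

Definition position (d : D) : nat := (tail d : 'I_(2 * n).+2).

Lemma slot_lt3 d : slot d < 3.
Proof. by case: d => [[[e|e]|e] []]. Qed.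

Lemma slot_port p k : k < 3 -> slot (port p k) = k.
Proof. by case: k => [|[|[|//]]] // _; rewrite /port; do 3?case: ifP. Qed.

Lemma position_port p k : p <= (2 * n).+1 -> k < 3 -> position (port p k) = p.
Proof.
case: k => [|[|[|//]]] ltp _; rewrite /port /position /tail /=.
- rewrite /= inordK; last by case: ifP; lia.
  by case: eqP => [->|]; [rewrite modnn | move=> p0; rewrite modn_small; lia].
- case: eqP => [->|p0] //=.
  case: (leqP p n) => pn /=; first by rewrite /cross_u !inordK; lia.
  case: (leqP p (2 * n)) => p2n /=; first by rewrite /cross_v !inordK; lia.
  lia.
- by rewrite inordK.
Qed.

Lemma port_u p : 0 < p <= n -> port p 1 = (inl (inr (inord p.-1)), false).
Proof.
move=> h; rewrite /port; have -> : (p == 0) = false by lia.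
by case/andP: h => _ ->.
Qed.

Lemma port_v p : n < p <= 2 * n -> port p 1 = (inl (inr (inord (p - n.+1))), true).
Proof.
move=> h; rewrite /port; have -> : (p == 0) = false by lia.
have -> : (p <= n) = false by lia.
by case/andP: h => _ ->.
Qed.

Lemma port_w' : port (2 * n).+1 1 = (inr tt, true).
Proof.
rewrite /port /=; have -> : (2 * n < n) = false by lia.
by rewrite ltnn.
Qed.

Lemma portK (d : D) : port (position d) (slot d) = d.
Proof.
case: d => [[[e|e]|[]] []] //; last exact: port_w'.
- rewrite /port /slot /position /tail /=.
  congr (inl (inl _), _); apply: ord_inj => /=; have := ltn_ord e.
  rewrite inordK; last by case: ifP => _; lia.
  move=> lte; case: (ltnP e (2 * n).+1) => [lte'|gee].
    by rewrite modn_small.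
  have -> : e = (2 * n).+1 :> nat by lia.
  by rewrite modnn.
- by rewrite /port /slot /position /tail /= inord_val.
- have lte := ltn_ord e; rewrite /slot /position /tail /= /cross_v inordK; last by lia.
  rewrite port_v; last by lia.
  congr (inl (inr _), _); apply: ord_inj; rewrite inordK; lia.
- have lte := ltn_ord e; rewrite /slot /position /tail /= /cross_u inordK; last by lia.
  rewrite port_u; last by lia.
  congr (inl (inr _), _); apply: ord_inj; rewrite inordK; lia.
Qed.

Lemma port_inj p k q l : p <= (2 * n).+1 -> q <= (2 * n).+1 -> k < 3 -> l < 3 ->
  port p k = port q l -> (p, k) = (q, l).
Proof.
move=> ltp ltq ltk ltl e.
by rewrite -(position_port ltp ltk) -(position_port ltq ltl) e -(slot_port p ltk) e slot_port.
Qed.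

Lemma flip_rail p : p <= 2 * n -> flip (cross n) (port p 2) = port p.+1 0.
Proof. by rewrite permE. Qed.

(** The partner v_(n-k+1) of u_k sits at position n + k of the cycle. The rungs therefore join two
    rails read in the same direction, which is what makes it possible to add them one by one. *)
Lemma flip_rung k : 0 < k <= n -> flip (cross n) (port k 1) = port (n + k) 1.
Proof.
move=> hk; rewrite permE /= port_u // port_v; last by lia.
by rewrite /reverse_dart /=; congr (inl (inr (inord _)), _); lia.
Qed.

Lemma flip_digon1 : flip (cross n) (port 0 1) = port (2 * n).+1 1.
Proof. by rewrite permE port_w'. Qed.

Lemma flip_digon2 : flip (cross n) (port (2 * n).+1 2) = port 0 0.
Proof. by rewrite permE. Qed.

End CrossDarts.

Arguments port : simpl never.

(** The two cyclic orders of the three slots at a cubic vertex. *)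
Definition turn (b : bool) k := if b then k.+1 %% 3 else k.+2 %% 3.

Lemma turn_lt3 b k : turn b k < 3.
Proof. by case: b; rewrite ltn_mod. Qed.

Lemma turn_inj b k l : k < 3 -> l < 3 -> turn b k = turn b l -> k = l.
Proof. by case: b; case: k => [|[|[|]]] //; case: l => [|[|[|]]]. Qed.

Definition bit_pairs : seq (bool * bool) :=
  [:: (true, true); (true, false); (false, true); (false, false)].

Fixpoint words k : seq (seq (bool * bool)) :=
  if k is k'.+1 then [seq x :: w | x <- bit_pairs, w <- words k'] else [:: [::]].

Lemma mem_words k w : (w \in words k) = (size w == k).
Proof.
elim: k w => [|k IH] w; first by rewrite inE size_eq0.
apply/allpairsP/idP => [[[x v] [_ /= vk ->]] | ]; first by rewrite /= eqSS -IH.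
case: w => // x w; rewrite /= eqSS -IH => wk.
by exists (x, w); split=> //; case: x => [[] []].
Qed.

Lemma words_uniq k : uniq (words k).
Proof.
elim: k => // k IH; apply: allpairs_uniq => //.
by move=> [x v] [y w] _ _ /= [-> ->].
Qed.

(** * Rotation systems of the cross as words of bits *)

Section CrossRotations.
Variable m : nat.
Local Notation n := m.+1.
Local Notation D := (dart (cross n)).
Local Notation port := (@port m).
Implicit Types (beta : nat -> bool) (d : D).

Lemma position_le d : position d <= (2 * n).+1.
Proof. by rewrite -ltnS /position ltn_ord. Qed.

Lemma tail_eqE d d' : (tail d == tail d') = (position d == position d').
Proof. by []. Qed.

Definition turn_dart beta d : D :=
  port (position d) (turn (beta (position d)) (slot d)).

Lemma turn_dart_inj beta : injective (turn_dart beta).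
Proof.
move=> d d' /(port_inj (position_le d) (position_le d') (turn_lt3 _ _) (turn_lt3 _ _)).
case=> epos; rewrite epos => /(turn_inj (slot_lt3 d) (slot_lt3 d')) eslot.
by rewrite -(portK d) epos eslot portK.
Qed.

Definition rotation beta : {perm D} := perm (@turn_dart_inj beta).

Lemma rotation_port beta p k : p <= (2 * n).+1 -> k < 3 ->
  rotation beta (port p k) = port p (turn (beta p) k).
Proof. by move=> lep ltk; rewrite permE /turn_dart position_port // slot_port. Qed.

Lemma porbit_rotation beta d :
  porbit (rotation beta) d = [set d' | tail d' == tail d].
Proof.
have lep := position_le d; have ltk := slot_lt3 d.
apply/setP => d'; rewrite inE tail_eqE; apply/porbitP/eqP => [[i ->] | epos].
  elim: i => [|i IH]; first by rewrite perm1.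
  by rewrite expgSr permM permE /turn_dart position_port ?position_le ?turn_lt3.
have iterE i : (rotation beta ^+ i)%g d
    = port (position d) (iter i (turn (beta (position d))) (slot d))
    /\ iter i (turn (beta (position d))) (slot d) < 3.
  elim: i => [|i [IH1 IH2]]; first by rewrite perm1 portK.
  by rewrite expgSr permM IH1 rotation_port //= turn_lt3.
suff [i e] : exists i, slot d' = iter i (turn (beta (position d))) (slot d).
  by exists i; have [-> _] := iterE i; rewrite -e -epos portK.
have := slot_lt3 d'; move: ltk; case: (beta _);
case: (slot d) => [|[|[|//]]] _; case: (slot d') => [|[|[|//]]] _;
by [exists 0 | exists 1 | exists 2].
Qed.

(** A cyclic order of three slots is determined by the image of slot 0, so one bit per vertex
    suffices. *)
Lemma rotation_system_rotation s : is_rotation_system s ->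
  s = rotation (fun p => s (port p 0) == port p 1).
Proof.
move=> /forallP rot; have orb d d' : (d' \in porbit s d) = (position d' == position d).
  by rewrite (eqP (rot d)) inE.
have closed p k : p <= (2 * n).+1 -> k < 3 -> exists2 l, l < 3 & s (port p k) = port p l.
  move=> lep ltk; exists (slot (s (port p k))); first exact: slot_lt3.
  have := orb (port p k) (s (port p k)); rewrite position_port //.
  rewrite -[s _]/((s ^+ 1)%g _) mem_porbit => /esym/eqP ep.
  by rewrite -{1}(portK (s (port p k))) ep.
(* A fixed slot, or two slots exchanged, would form an orbit that misses some slot of the vertex.
   With injectivity this leaves only the two 3-cycles among the 27 maps enumerated below. *)
have nofix p k l : p <= (2 * n).+1 -> k < 3 -> l < 3 -> k != l ->
    s (port p k) != port p k /\ ~~ ((s (port p k) == port p l) && (s (port p l) == port p k)).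
  move=> lep ltk ltl kl; have neq : port p l \in porbit s (port p k).
    by rewrite orb !position_port.
  have pneq x y : x < 3 -> y < 3 -> x != y -> port p x <> port p y.
    by move=> ltx lty /eqP xy /(port_inj lep lep ltx lty) [].
  split.
    apply/negP => /eqP sk; have /porbitP[i] := neq.
    suff -> : (s ^+ i)%g (port p k) = port p k by apply: pneq; rewrite // eq_sym.
    by elim: i => [|i IH]; rewrite ?perm1 // expgSr permM IH.
  apply/negP => /andP[/eqP skl /eqP slk].
  have [r [ltr rk rl]] : exists r, [/\ r < 3, r != k & r != l].
    move: ltk ltl kl; case: k {neq skl slk} => [|[|[|//]]]; case: l => [|[|[|//]]] //;
    by [exists 0 | exists 1 | exists 2].
  have /porbitP[i] : port p r \in porbit s (port p k) by rewrite orb !position_port.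
  suff [-> | ->] : (s ^+ i)%g (port p k) = port p k \/ (s ^+ i)%g (port p k) = port p l.
  - exact: pneq.
  - exact: pneq.
  elim: i => [|i [] IH]; first by rewrite perm1; left.
  - by right; rewrite expgSr permM IH.
  - by left; rewrite expgSr permM IH.
apply/permP => d; rewrite -(portK d); move: (position_le d) (slot_lt3 d).
move: (position d) (slot d) => p k lep ltk.
rewrite rotation_port //.
have [n01 c01] := nofix p 0 1 lep isT isT isT.
have [n02 c02] := nofix p 0 2 lep isT isT isT.
have [n10 c10] := nofix p 1 0 lep isT isT isT.
have [n12 c12] := nofix p 1 2 lep isT isT isT.
have [n20 _] := nofix p 2 0 lep isT isT isT.
have inj x y : x < 3 -> y < 3 -> (port p x == port p y) = (x == y).
  by move=> ltx lty; apply/eqP/eqP => [/(port_inj lep lep ltx lty) [] | ->].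
have sinj x y : x < 3 -> y < 3 -> (s (port p x) == s (port p y)) = (x == y).
  by move=> ltx lty; rewrite (inj_eq perm_inj) inj.
have s01 := sinj 0 1 isT isT; have s02 := sinj 0 2 isT isT; have s12 := sinj 1 2 isT isT.
have [[|[|[|//]]] _ e0] := closed p 0 lep isT;
have [[|[|[|//]]] _ e1] := closed p 1 lep isT;
have [[|[|[|//]]] _ e2] := closed p 2 lep isT;
move: n01 c01 n02 c02 n10 c10 n12 c12 n20 s01 s02 s12; rewrite ?e0 ?e1 ?e2 ?inj //= => *;
by case: k ltk => [|[|[|//]]] _; rewrite ?e0 ?e1 ?e2.
Qed.

(* The [l]-th pair of a word holds the bits of u_(l+1) and of position
   n + l + 1; the last pair holds those of w and w'. *)
Definition bits_of (w : seq (bool * bool)) p : bool :=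
  if p == 0 then (nth (false, false) w n).1
  else if p <= n then (nth (false, false) w p.-1).1
  else if p <= 2 * n then (nth (false, false) w (p - n.+1)).2
  else (nth (false, false) w n).2.

Definition word_of beta : seq (bool * bool) :=
  mkseq (fun l => if l < n then (beta l.+1, beta (n + l.+1))
                  else (beta 0, beta (2 * n).+1)) n.+1.

Lemma bits_of_u w l : l < n -> bits_of w l.+1 = (nth (false, false) w l).1.
Proof. by move=> ltl; rewrite /bits_of /= ltl. Qed.

Lemma bits_of_v w l : l < n -> bits_of w (n + l.+1) = (nth (false, false) w l).2.
Proof.
move=> ltl; rewrite /bits_of addSn /=.
have -> : (m + l.+1 < n) = false by lia.
have -> : m + l.+1 < 2 * n by lia.
by congr (nth _ _ _).2; lia.
Qed.

Lemma bits_of_w w : bits_of w 0 = (nth (false, false) w n).1.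
Proof. by []. Qed.

Lemma bits_of_w' w : bits_of w (2 * n).+1 = (nth (false, false) w n).2.
Proof.
rewrite /bits_of /=; have -> : (2 * n < n) = false by lia.
by rewrite ltnn.
Qed.

Lemma bits_ofK w : size w = n.+1 -> word_of (bits_of w) = w.
Proof.
move=> sz; apply: (@eq_from_nth _ (false, false)); first by rewrite size_mkseq.
rewrite size_mkseq => l lel; rewrite nth_mkseq //; case: ltnP => ltl.
  by rewrite bits_of_u // bits_of_v // -surjective_pairing.
have -> : l = n by lia.
by rewrite bits_of_w bits_of_w' -surjective_pairing.
Qed.

Lemma word_ofK beta p : p <= (2 * n).+1 -> bits_of (word_of beta) p = beta p.
Proof.
move=> lep; have [->|p0] := posnP p.
  by rewrite bits_of_w nth_mkseq // ltnn.
have [pn|np] := leqP p n.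
  by case: p p0 pn {lep} => // p _ ltp; rewrite bits_of_u // nth_mkseq ?ltp //; lia.
have [p2n|n2p] := leqP p (2 * n).
  have [l ltl ->] : exists2 l, l < n & p = n + l.+1 by exists (p - n.+1); lia.
  by rewrite bits_of_v // nth_mkseq ?ltl //; lia.
have -> : p = (2 * n).+1 by lia.
by rewrite bits_of_w' nth_mkseq // ltnn.
Qed.

Lemma eq_rotation beta beta' : (forall p, p <= (2 * n).+1 -> beta p = beta' p) ->
  rotation beta = rotation beta'.
Proof.
by move=> e; apply/permP => d; rewrite !permE /turn_dart e // position_le.
Qed.

Lemma rotation_inj beta beta' : rotation beta = rotation beta' ->
  forall p, p <= (2 * n).+1 -> beta p = beta' p.
Proof.
move=> e p lep; have := congr1 (fun s : {perm D} => s (port p 0)) e.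
rewrite !rotation_port // => /(port_inj lep lep (turn_lt3 _ _) (turn_lt3 _ _)) [].
by case: (beta p); case: (beta' p).
Qed.

Lemma embeddings_of_genus_words i : embeddings_of_genus (cross n) i
  = count (fun w => genus (rotation (bits_of w)) == i) (words n.+1).
Proof.
set L := [seq rotation (bits_of w) | w <- words n.+1].
have uL : uniq L.
  rewrite map_inj_in_uniq ?words_uniq // => v w; rewrite !mem_words.
  move=> /eqP szv /eqP szw /rotation_inj e.
  by rewrite -(bits_ofK szv) -(bits_ofK szw); apply: eq_mkseq => l;
     case: ltnP => ltl; rewrite !e //; lia.
rewrite -[RHS]/(count (preim _ (fun s => genus s == i)) _) -count_map -/L -size_filter.
rewrite -(card_uniqP (filter_uniq _ uL)); apply: eq_card => s.
rewrite !inE mem_filter andbC; congr (_ && _); apply/idP/mapP => [rot | [w _ ->]].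
  exists (word_of (fun p => s (port p 0) == port p 1)).
    by rewrite mem_words size_mkseq.
  rewrite {1}(rotation_system_rotation rot).
  by apply: eq_rotation => p lep; rewrite word_ofK.
by apply/forallP => d; rewrite porbit_rotation.
Qed.

End CrossRotations.

(** * Counting faces rung by rung *)

Definition triangle b o : seq nat := [seq o + turn b k | k <- iota 0 3].

Definition restrict (sel f : seq nat) : seq nat := [seq index (nth 0 f i) sel | i <- sel].

(* A state is the list of images of 0, 1, 2, 3 under the permutation that the faces
   induce on the open darts of the first k rungs: those at u_1 and at position n + 1
   (slot 0), and those at u_k and at position n + k (slot 2). The three darts of the two
   next vertices get the indices 4, 5, 6 and 7, 8, 9 in the order of their slots. *)
Definition start_edges : seq (nat * nat) := [:: (1, 4)].
Definition rung_edges : seq (nat * nat) := [:: (5, 8); (2, 4); (3, 7)].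
(** The two new vertices are now w and w'. In order: the extra edge ww', the cycle edge w'w, then w
    u_1, w' v_1 and u_n v_n. *)
Definition closing_edges : seq (nat * nat) :=
  [:: (5, 8); (4, 9); (6, 0); (7, 3); (2, 1)].

Definition start_selection := [:: 0; 3; 2; 5].
Definition rung_selection := [:: 0; 1; 6; 9].

Definition start_darts (x : bool * bool) := triangle x.1 0 ++ triangle x.2 3.
Definition more_darts (p : seq nat) (x : bool * bool) := p ++ triangle x.1 4 ++ triangle x.2 7.

Definition start_state x : seq nat :=
  restrict start_selection (glue_all start_edges (iota 0 6) (start_darts x)).1.2.
Definition next_state p x : seq nat :=
  restrict rung_selection (glue_all rung_edges (iota 0 10) (more_darts p x)).1.2.
(** Attaching two new vertices takes two merges; only the further ones raise the genus. The finite
    checks below guarantee that the subtraction does not truncate. The first rung needs a single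
    merge, and [start_ok] confirms that it has exactly one. *)
Definition next_genus p x : nat :=
  (glue_all rung_edges (iota 0 10) (more_darts p x)).2 - 2.
Definition closing_genus p x : nat :=
  (glue_all closing_edges (iota 0 10) (more_darts p x)).2 - 2.

Definition states := permutations (iota 0 4).

Definition selectable (sel lv f : seq nat) :=
  all (fun i => (i \in lv) && (nth 0 f i \in sel)) sel.

Lemma start_ok :
  all (fun x => let: (lv, f, k) := glue_all start_edges (iota 0 6) (start_darts x) in
    [&& gluable_all start_edges (iota 0 6) (start_darts x),
        selectable start_selection lv f, k == 1 & start_state x \in states]) bit_pairs.
Proof. by vm_compute. Qed.

Lemma next_ok :
  all (fun p => all (fun x =>
    let: (lv, f, k) := glue_all rung_edges (iota 0 10) (more_darts p x) in
    [&& gluable_all rung_edges (iota 0 10) (more_darts p x),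
        selectable rung_selection lv f, 1 < k & next_state p x \in states]) bit_pairs) states.
Proof. by vm_compute. Qed.

Lemma closing_ok :
  all (fun p => all (fun x =>
    let: (lv, f, k) := glue_all closing_edges (iota 0 10) (more_darts p x) in
    gluable_all closing_edges (iota 0 10) (more_darts p x) && (1 < k)) bit_pairs) states.
Proof. by vm_compute. Qed.

Fixpoint run p (w : seq (bool * bool)) : nat :=
  match w with
  | [::] => 0
  | [:: x] => closing_genus p x
  | x :: w' => next_genus p x + run (next_state p x) w'
  end.

Section Represent.
Variables (D : finType) (x0 : D).
Implicit Types (s : {perm D}) (ps : seq D) (lv sel f p : seq nat).

Lemma represents_restrict ps lv sel f s :
    represents x0 ps lv f s -> selectable sel lv f ->
  represents x0 [seq nth x0 ps i | i <- sel] (iota 0 (size sel)) (restrict sel f) s.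
Proof.
move=> rep /allP ok i; rewrite mem_iota /= add0n => lti.
have /andP[ilv fisel] := ok _ (mem_nth 0 lti).
have lti' : index (nth 0 f (nth 0 sel i)) sel < size sel by rewrite index_mem.
by rewrite (nth_map 0) // rep // (nth_map 0) // (nth_map 0) // nth_index.
Qed.

End Represent.

(** * The edge involution restricted to the darts not yet glued *)

Section PartialFlip.
Variable G : multigraph.
Local Notation D := (dart G).
Implicit Types (A : {set D}) (d : D).

Lemma flipK : involutive (flip G).
Proof. by move=> d; rewrite !permE reverse_dartK. Qed.

(** [A] is meant to hold the darts whose edges remain to be glued. The involution on what is left
    plays the part of [t] in the gluing lemmas. *)
Definition flip_on A d : D := if (d \in A) && (flip G d \in A) then flip G d else d.

Lemma flip_onK A : involutive (flip_on A).
Proof.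
move=> d; rewrite /flip_on; case dA: (d \in A); case fdA: (flip G d \in A);
by rewrite /= ?flipK ?dA ?fdA.
Qed.

Definition partial_flip A : {perm D} := perm (inv_inj (flip_onK A)).

Lemma partial_flipE A d : partial_flip A d = flip_on A d.
Proof. by rewrite permE. Qed.

Lemma partial_flipT : partial_flip setT = flip G.
Proof. by apply/permP => d; rewrite partial_flipE /flip_on !inE. Qed.

Lemma partial_flip_notin A d : d \notin A -> partial_flip A d = d.
Proof. by move=> dA; rewrite permE /flip_on (negbTE dA). Qed.

Lemma partial_flip0 A : #|A| = 0 -> partial_flip A = 1%g.
Proof.
move=> /eqP; rewrite cards_eq0 => /eqP ->.
by apply/permP => d; rewrite partial_flip_notin ?inE // perm1.
Qed.

Lemma partial_flipD A d : d \in A -> flip G d \in A ->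
  partial_flip A = (partial_flip (A :\: [set d; flip G d]) * tperm d (flip G d))%g.
Proof.
move=> dA fdA; apply/permP => e; rewrite permM !partial_flipE /flip_on !inE !negb_or.
case: (eqVneq e d) => [-> | ed]; first by rewrite dA fdA /= tpermL.
case: (eqVneq e (flip G d)) => [-> | efd].
  by rewrite flipK dA fdA /= tpermR.
have fed : flip G e != d by rewrite (can2_eq flipK flipK).
have fefd : flip G e != flip G d by rewrite (inj_eq perm_inj).
by rewrite fed fefd /=; case: ifP => _; rewrite tpermD // eq_sym.
Qed.

Definition edge_indices (es : seq (nat * nat)) := flatten [seq [:: e.1; e.2] | e <- es].

Lemma partial_flip_tperms x0 (ps : seq D) es A :
    uniq ps -> uniq (edge_indices es) -> all (fun i => i < size ps) (edge_indices es) ->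
    (forall e, e \in es -> flip G (nth x0 ps e.1) = nth x0 ps e.2) ->
    (forall i, i \in edge_indices es -> nth x0 ps i \in A) ->
  let A' := A :\: [set z in [seq nth x0 ps i | i <- edge_indices es]] in
  partial_flip A = (partial_flip A' * tperms x0 ps es)%g
  /\ #|A| = #|A'| + (size es).*2.
Proof.
move=> ups; elim: es A => [|[i j] es IH] A /=.
  move=> _ _ _ _; rewrite mulg1 addn0.
  have -> : A :\: [set z in [::]] = A by apply/setP => z; rewrite !inE.
  by [].
rewrite -/(edge_indices es) inE negb_or => /and3P[/andP[ij ies] jes ues].
move=> /and3P[lti ltj ltes] fl inA.
have fij := fl (i, j) (mem_head _ _); rewrite /= in fij.
have iA : nth x0 ps i \in A by apply: inA; rewrite mem_head.
have jA : nth x0 ps j \in A by apply: inA; rewrite !inE eqxx orbT.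
have := partial_flipD iA; rewrite fij => /(_ jA) ->.
set A1 := A :\: _; have [e ees | k kes |] := IH A1 ues ltes.
- by apply: fl; rewrite inE ees orbT.
- rewrite !inE inA; last by rewrite !inE kes !orbT.
  have ltk := allP ltes _ kes; rewrite andbT negb_or !nth_uniq //.
  by apply/andP; split; apply: contraTneq kes => ->.
have -> : A1 :\: [set z in [seq nth x0 ps i | i <- edge_indices es]]
  = A :\: [set z in nth x0 ps i :: nth x0 ps j :: [seq nth x0 ps i | i <- edge_indices es]].
  by apply/setP => z; rewrite !inE !negb_or -!andbA; do 2?case: eqP; rewrite ?andbF.
move=> -> cardA1; split; first by rewrite mulgA.
have : #|A1| = #|A| - 2.
  rewrite cardsD; have /setIidPr -> : [set nth x0 ps i; nth x0 ps j] \subset A.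
    by apply/subsetP => z; rewrite !inE => /orP[] /eqP ->.
  by rewrite cards2 nth_uniq // ij.
have : 1 < #|A|.
  have <- : #|[set nth x0 ps i; nth x0 ps j]| = 2 by rewrite cards2 nth_uniq // ij.
  by apply: subset_leq_card; apply/subsetP => z; rewrite !inE => /orP[] /eqP ->.
rewrite cardA1 doubleS; move: (#|A :\: _|) (#|A|) (_.*2) => a b c; lia.
Qed.

End PartialFlip.

(** The remaining set is described only by a closure property and a cardinality: the first keeps the
    darts of later steps available, the second shows at the end that nothing is left. *)
Lemma glue_all_partial_flip (G : multigraph) x0 (ps : seq (dart G)) es lv f s (A : {set dart G}) :
    uniq ps -> all (fun i => i < size ps) lv -> represents x0 ps lv f s ->
    gluable_all es lv f ->
    uniq (edge_indices es) -> all (fun i => i < size ps) (edge_indices es) ->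
    (forall e, e \in es -> flip G (nth x0 ps e.1) = nth x0 ps e.2) ->
    {subset ps <= A} ->
  let: (lv', f', k) := glue_all es lv f in
  exists (s' : {perm dart G}) (A' : {set dart G}),
  [/\ represents x0 ps lv' f' s',
      forall d, d \notin ps -> s d \notin ps -> s' d = s d,
      forall d, d \in A -> d \notin [seq nth x0 ps i | i <- edge_indices es] -> d \in A',
      #|A| = #|A'| + (size es).*2
    & #|porbits (partial_flip A * s)%g| + #|porbits s'| + k.*2
      = #|porbits (partial_flip A' * s')%g| + #|porbits s| + size es].
Proof.
move=> ups ltlv rep ok ues ltes fl inA.
have psA i : i \in edge_indices es -> nth x0 ps i \in A.
  by move=> ies; apply/inA/mem_nth/(allP ltes).
have [-> ->] := partial_flip_tperms ups ues ltes fl psA.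
have := glue_all_porbits ups ltlv rep ok.
case: (glue_all es lv f) => [[lv' f'] k] [s' [rep' frame cnt]].
exists s'; eexists; split; [exact: rep' | exact: frame | | by [] | ].
  by move=> d dA dps; rewrite !inE dA dps.
rewrite -mulgA; apply: cnt => e ees.
have mem i : i \in [:: e.1; e.2] -> i \in edge_indices es.
  by move=> ie; apply/flattenP; exists [:: e.1; e.2] => //; apply: map_f.
by split; apply: partial_flip_notin; rewrite !inE map_f ?mem ?inE ?eqxx ?orbT.
Qed.

Lemma states_lt4 p : p \in states -> size p = 4 /\ {in p, forall i, i < 4}.
Proof.
rewrite mem_permutations => pp; split; first by rewrite (perm_size pp).
by move=> i; rewrite (perm_mem pp) mem_iota.
Qed.

(** * From the rotation of the cross to a run through the states *)

Section CrossFaces.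
Variables (m : nat) (w : seq (bool * bool)).
Local Notation n := m.+1.
Local Notation D := (dart (cross n)).
Local Notation port := (@port m).
Local Notation beta := (bits_of m w).
Implicit Types (s : {perm D}) (A : {set D}).

Hypothesis size_w : size w = n.+1.

Definition port_of (e : nat * nat) : D := port e.1 e.2.

Lemma port_of_inj (ps : seq (nat * nat)) :
    all (fun e => (e.1 <= (2 * n).+1) && (e.2 < 3)) ps ->
  {in ps &, injective port_of}.
Proof.
move=> /allP ok [p k] [q l] /ok /andP[lep ltk] /ok /andP[leq ltl].
exact: port_inj.
Qed.

Lemma port_of_notin ps p k : p <= (2 * n).+1 -> k < 3 ->
    all (fun e => (e.1 <= (2 * n).+1) && (e.2 < 3)) ps -> (p, k) \notin ps ->
  port p k \notin map port_of ps.
Proof.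
move=> lep ltk /allP ok; apply: contra => /mapP [[q l] inps].
have /andP[leq ltl] := ok _ inps.
by move=> /(port_inj lep leq ltk ltl) ->.
Qed.

Definition boundary (k : nat) := [:: (1, 0); (n.+1, 0); (k, 2); (n + k, 2)].
Definition vertex_ports (q : nat) := [:: (q, 0); (q, 1); (q, 2)].
Definition new_ports k q q' := boundary k ++ vertex_ports q ++ vertex_ports q'.

Definition untouched k q := [|| k < q <= n, n + k < q <= (2 * n).+1 | q == 0].

Lemma mem_vertex_ports q e l : ((e, l) \in vertex_ports q) = (e == q) && (l < 3).
Proof.
by rewrite !inE !xpair_eqE; case: eqP => //= _; case: l => [|[|[|]]].
Qed.

Lemma represents_more k q q' p s :
    p \in states ->
    represents (port 0 0) (map port_of (boundary k)) (iota 0 4) p s ->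
    (forall l, l < 3 -> s (port q l) = port q (turn (beta q) l)) ->
    (forall l, l < 3 -> s (port q' l) = port q' (turn (beta q') l)) ->
  represents (port 0 0) (map port_of (new_ports k q q')) (iota 0 10)
    (more_darts p (beta q, beta q')) s.
Proof.
move=> /states_lt4 [sp ltp] rep sq sq' i; rewrite mem_iota /= add0n /more_darts => lti.
have old j : j < 4 -> nth (port 0 0) (map port_of (new_ports k q q')) j
    = nth (port 0 0) (map port_of (boundary k)) j.
  by move=> ltj; rewrite map_cat nth_cat size_map ltj.
have [lti4|lei4] := ltnP i 4.
  rewrite old // rep ?mem_iota // nth_cat sp lti4 old //.
  by apply/ltp/mem_nth; rewrite sp.
rewrite nth_cat sp ltnNge lei4 /=.
have [j ltj ->] : exists2 j, j < 6 & i = 4 + j by exists (i - 4); lia.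
rewrite addKn.
case: j ltj => [|[|[|[|[|[|//]]]]]]  _; rewrite /triangle /= /port_of /= ?sq ?sq' //;
by case: (beta q); case: (beta q').
Qed.

Lemma run_cons p x ws : 0 < size ws ->
  run p (x :: ws) = next_genus p x + run (next_state p x) ws.
Proof. by case: ws. Qed.

Lemma mem_bit_pairs x : x \in bit_pairs.
Proof. by case: x => [[] []]. Qed.

(** This is F + 2M = (orbits of [s]) + E for the part still to be glued: r rungs with three edges
    each and five closing edges give E = 3r + 5 and twice as many darts in [A], and M consists of
    2(r + 1) merges attaching new vertices plus the genus increments of [run]. *)
Lemma run_porbits r k p s A :
    k + r = n -> 0 < k -> p \in states ->
    represents (port 0 0) (map port_of (boundary k)) (iota 0 4) p s ->
    (forall q l, untouched k q -> l < 3 -> s (port q l) = port q (turn (beta q) l)) ->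
    {subset map port_of (boundary k) <= A} ->
    (forall q l, untouched k q -> l < 3 -> port q l \in A) ->
    #|A| = 6 * r + 10 ->
  #|porbits (partial_flip A * s)%g| + (2 * r.+1 + run p (drop k w)).*2
    = #|porbits s| + (3 * r + 5).
Proof.
elim: r k p s A => [|r IH] k p s A kr k0 pst rep sunt bA untA cardA.
  have kn : k = n by lia.
  have -> : drop k w = [:: (beta 0, beta (2 * n).+1)].
    rewrite kn (drop_nth (false, false)) ?size_w // drop_oversize ?size_w //.
    by rewrite bits_of_w' bits_of_w -surjective_pairing.
  set q := 0; set q' := (2 * n).+1; set ps := map port_of (new_ports k q q').
  have bnd : all (fun e => (e.1 <= (2 * n).+1) && (e.2 < 3)) (new_ports k q q').
    by rewrite /= /q /q' !andbT; lia.
  have ups : uniq ps.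
    rewrite map_inj_in_uniq; last exact: port_of_inj.
    by rewrite /= !inE !xpair_eqE /q /q' /=; lia.
  have untq : untouched k q by rewrite /untouched /q; lia.
  have untq' : untouched k q' by rewrite /untouched /q'; lia.
  have psA : {subset ps <= A}.
    move=> d; rewrite /ps map_cat mem_cat => /orP[/bA //|].
    case/mapP => -[e l]; rewrite mem_cat !mem_vertex_ports => h ->; apply: untA;
    by case/orP: h => /andP[/eqP ->].
  have rep10 := represents_more pst rep (sunt q ^~ untq) (sunt q' ^~ untq').
  have fl e : e \in closing_edges ->
      flip (cross n) (nth (port 0 0) ps e.1) = nth (port 0 0) ps e.2.
    rewrite !inE => /or4P[||| /orP[]] /eqP -> /=; rewrite /port_of /=.
    - exact: flip_digon1.
    - by rewrite -[RHS]flipK flip_digon2.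
    - exact: flip_rail.
    - rewrite -[RHS]flipK flip_rail ?/q' ?kn; last by lia.
      by congr (flip _ (port _ _)); lia.
    - by rewrite flip_rail kn //; lia.
  have := allP (allP closing_ok _ pst) _ (mem_bit_pairs (beta q, beta q')).
  have := @glue_all_partial_flip _ _ ps closing_edges (iota 0 10) _ _ A ups isT rep10.
  rewrite /run /closing_genus.
  case: (glue_all _ _ _) => [[lv f] M] /= glueP /andP[ok M2].
  have [s' [A' [_ _ _ cardA' cnt]]] := glueP ok isT isT fl psA.
  (* The closing edges use the last ten darts. The remaining involution is the identity, and the two
     counts of orbits of [s'] cancel. *)
  have A'0 : #|A'| = 0 by move: cardA' cardA => /= ->; clear; lia.
  rewrite (partial_flip0 A'0) mul1g in cnt.
  by move: cnt M2 => /=; clear; lia.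
have ltk : k < n by lia.
have -> : drop k w = (beta k.+1, beta (n + k.+1)) :: drop k.+1 w.
  rewrite (drop_nth (false, false)) ?size_w; last by lia.
  by rewrite bits_of_u // bits_of_v // -surjective_pairing.
rewrite run_cons; last by rewrite size_drop size_w; lia.
set q := k.+1; set q' := n + k.+1; set ps := map port_of (new_ports k q q').
have bnd : all (fun e => (e.1 <= (2 * n).+1) && (e.2 < 3)) (new_ports k q q').
  by rewrite /= /q /q' !andbT; lia.
have ups : uniq ps.
  rewrite map_inj_in_uniq; last exact: port_of_inj.
  by rewrite /= !inE !xpair_eqE /q /q' /=; lia.
have untq : untouched k q by rewrite /untouched /q; lia.
have untq' : untouched k q' by rewrite /untouched /q'; lia.
have psA : {subset ps <= A}.
  move=> d; rewrite /ps map_cat mem_cat => /orP[/bA //|].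
  case/mapP => -[e l]; rewrite mem_cat !mem_vertex_ports => h ->; apply: untA;
  by case/orP: h => /andP[/eqP ->].
have rep10 := represents_more pst rep (sunt q ^~ untq) (sunt q' ^~ untq').
have fl e : e \in rung_edges -> flip (cross n) (nth (port 0 0) ps e.1) = nth (port 0 0) ps e.2.
  rewrite !inE => /or3P[] /eqP -> /=; rewrite /port_of /=.
  - by rewrite flip_rung // /q; lia.
  - by rewrite flip_rail //; lia.
  - by rewrite flip_rail ?/q' ?addnS //; lia.
have := allP (allP next_ok _ pst) _ (mem_bit_pairs (beta q, beta q')).
have := @glue_all_partial_flip _ _ ps rung_edges (iota 0 10) _ _ A ups isT rep10.
rewrite /next_genus /next_state.
case: (glue_all _ _ _) => [[lv f] M] /= glueP /and4P[ok sel M2 pst'].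
have [s' [A' [rep' frame keepA cardA' cnt]]] := glueP ok isT isT fl psA.
have rep4 := represents_restrict rep' sel.
have untS e : untouched q e -> untouched k e && (e <= (2 * n).+1).
  by clear; rewrite /untouched /q; lia.
have fresh e l : untouched q e -> l < 3 -> port e l \notin ps.
  move=> une ltl; have /andP[_ lee] := untS _ une.
  apply: port_of_notin => //.
  rewrite !mem_cat !mem_vertex_ports !inE !xpair_eqE; move: une.
  by clear -k0 ltk q q'; rewrite /untouched /q /q'; lia.
have eps : [seq nth (port 0 0) ps i | i <- rung_selection] = map port_of (boundary q) by [].
have kept e l : port e l \in A -> (e, l) \notin
    [:: (q, 1); (q', 1); (k, 2); (q, 0); (n + k, 2); (q', 0)] ->
    e <= (2 * n).+1 -> l < 3 -> port e l \in A'.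
  move=> elA notin lee ltl; apply: keepA => //.
  by apply: (@port_of_notin [:: (q, 1); (q', 1); (k, 2); (q, 0); (n + k, 2); (q', 0)]) => //;
     clear -k0 ltk q q'; rewrite /= /q /q'; lia.
have bA' : {subset map port_of (boundary q) <= A'}.
  move=> d /mapP [[e l] h ->]; have elA : port e l \in A.
    by apply: psA; apply/mapP; exists (e, l) => //; move: h; rewrite !inE => h;
       case/or4P: h => /eqP ->; rewrite eqxx ?orbT.
  move: h elA; rewrite !inE !xpair_eqE => /or4P[] /andP[/eqP -> /eqP ->] elA;
  by apply: kept => //; clear -k0 ltk q q'; rewrite ?inE ?xpair_eqE ?/q ?/q' /=; lia.
have untA' e l : untouched q e -> l < 3 -> port e l \in A'.
  move=> une ltl; have /andP[unke lee] := untS _ une.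
  apply: kept => //; first exact: untA.
  by move: une; rewrite !inE !xpair_eqE /untouched; clear -k0 ltk q q'; rewrite ?/q ?/q'; lia.
have sunt' e l : untouched q e -> l < 3 -> s' (port e l) = port e (turn (beta e) l).
  move=> une ltl; have /andP[unke _] := untS _ une.
  by rewrite frame ?sunt ?fresh ?turn_lt3.
have cA' : #|A'| = 6 * r + 10 by move: cardA' cardA => /= ->; clear; lia.
have qr : q + r = n by rewrite addSnnS.
rewrite eps in rep4.
have := IH q _ s' A' qr isT pst' rep4 sunt' bA' untA' cA'.
move: cnt M2 => /=; rewrite -/q; clear.
by move: (#|porbits s|) (#|porbits s'|) (#|porbits _|) (#|porbits _|) (run _ _) => *; lia.
Qed.

Lemma card_porbits_rotation : #|porbits (rotation m beta)| = (2 * n).+2.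
Proof.
have -> : porbits (rotation m beta)
    = [set [set d : D | position d == v] | v : 'I_(2 * n).+2].
  apply/setP => X; apply/imsetP/imsetP => [[d _ ->] | [v _ ->]].
    by exists (tail d); rewrite // porbit_rotation.
  exists (port v 0) => //; rewrite porbit_rotation.
  by apply/setP => d; rewrite !inE tail_eqE position_port // -ltnS ltn_ord.
rewrite card_imset ?card_ord // => u v /setP/(_ (port u 0)).
rewrite !inE position_port // -1?ltnS ?ltn_ord // eqxx => /esym/eqP.
exact: ord_inj.
Qed.

Lemma genus_rotation :
  genus (rotation m beta) = run (start_state (head (false, false) w)) (behead w).
Proof.
have -> : head (false, false) w = (beta 1, beta n.+1).
  rewrite bits_of_u // -[n.+1](addn1 n) bits_of_v // -surjective_pairing.
  by case: (w) size_w.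
rewrite -drop1; set s := rotation m _.
set ps := map port_of (vertex_ports 1 ++ vertex_ports n.+1).
have ups : uniq ps.
  rewrite map_inj_in_uniq; first by rewrite /= !inE !xpair_eqE /=; lia.
  by apply: port_of_inj; rewrite /= !andbT; lia.
have rep6 : represents (port 0 0) ps (iota 0 6) (start_darts (beta 1, beta n.+1)) s.
  have rotE q l : q <= (2 * n).+1 -> l < 3 -> s (port q l) = port q (turn (beta q) l).
    exact: rotation_port.
  move=> i; rewrite mem_iota /= add0n /start_darts.
  case: i => [|[|[|[|[|[|//]]]]]] _; rewrite /triangle /= /port_of /= rotE //; try lia;
  by case: (beta 1); case: (beta n.+1).
have fl e : e \in start_edges -> flip (cross n) (nth (port 0 0) ps e.1) = nth (port 0 0) ps e.2.
  rewrite !inE => /eqP -> /=; rewrite /port_of /= flip_rung //.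
  by rewrite addn1.
have psT : {subset ps <= [set: D]} by move=> d _; rewrite inE.
have := allP start_ok _ (mem_bit_pairs (beta 1, beta n.+1)).
have := @glue_all_partial_flip _ _ ps start_edges (iota 0 6) _ _ setT ups isT rep6.
rewrite /start_state.
case: (glue_all _ _ _) => [[lv f] M] /= glueP /and4P[ok sel /eqP M1 pst].
have [s' [A' [rep' frame keepA cardA' cnt]]] := glueP ok isT isT fl psT.
have rep4 := represents_restrict rep' sel.
have eps : [seq nth (port 0 0) ps i | i <- start_selection] = map port_of (boundary 1).
  by rewrite /boundary addn1.
rewrite eps in rep4.
have fresh e l : untouched 1 e -> l < 3 -> e <= (2 * n).+1 /\ port e l \notin ps.
  move=> une ltl; have lee : e <= (2 * n).+1 by move: une; rewrite /untouched; lia.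
  split=> //; apply: port_of_notin => //; first by rewrite /= !andbT; lia.
  by rewrite mem_cat !mem_vertex_ports; move: une; rewrite /untouched; lia.
have sunt e l : untouched 1 e -> l < 3 -> s' (port e l) = port e (turn (beta e) l).
  move=> une ltl; have [lee nps] := fresh e l une ltl.
  by rewrite frame ?rotation_port // (fresh e _ une (turn_lt3 _ _)).2.
have kept e l : e <= (2 * n).+1 -> l < 3 -> l != 1 -> port e l \in A'.
  move=> lee ltl l1; apply: keepA; first by rewrite inE.
  apply: (@port_of_notin [:: (1, 1); (n.+1, 1)]) => //; first by rewrite /= !andbT; lia.
  by rewrite !inE !xpair_eqE (negbTE l1) !andbF.
have bA : {subset map port_of (boundary 1) <= A'}.
  move=> d /mapP [[e l]]; rewrite !inE !xpair_eqE.
  by case/or4P => /andP[/eqP -> /eqP ->] ->; apply: kept => //=; clear; lia.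
have untA e l : untouched 1 e -> l < 3 -> port e l \in A'.
  move=> une ltl; have [lee nps] := fresh e l une ltl.
  apply: keepA; rewrite ?inE //; apply: contra nps.
  by rewrite !inE => /orP[] /eqP ->; rewrite eqxx ?orbT.
have cA : #|D| = 6 * n + 6.
  by rewrite card_prod card_bool !card_sum !card_ord card_unit; lia.
have cA' : #|A'| = 6 * m + 10 by move: cardA' cA; rewrite cardsT /=; lia.
have := @run_porbits m 1 _ _ _ (add1n m) isT pst rep4 sunt bA untA cA'.
move: cnt; rewrite M1 partial_flipT card_porbits_rotation /genus /faces.
rewrite /= !card_sum !card_ord card_unit -/s.
move: (#|porbits s'|) (#|porbits _|) (#|porbits _|) (run _ _) => a b c R.
clear; lia.
Qed.

End CrossFaces.

(** * Genus polynomials *)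

(* States in the same class have the same generating polynomials [genus_poly]. *)
Definition state_classes : seq (seq (seq nat)) := [::
  [:: [:: 3; 2; 0; 1]; [:: 2; 3; 1; 0]];
  [:: [:: 1; 3; 0; 2]; [:: 2; 0; 3; 1]];
  [:: [:: 2; 3; 0; 1]];
  [:: [:: 3; 1; 0; 2]; [:: 2; 1; 3; 0]];
  [:: [:: 0; 2; 3; 1]; [:: 0; 3; 1; 2]];
  [:: [:: 3; 2; 1; 0]];
  [:: [:: 1; 2; 0; 3]; [:: 2; 0; 1; 3]];
  [:: [:: 1; 0; 3; 2]];
  [:: [:: 1; 3; 2; 0]; [:: 3; 0; 2; 1]];
  [:: [:: 2; 1; 0; 3]];
  [:: [:: 0; 1; 3; 2]];
  [:: [:: 3; 1; 2; 0]];
  [:: [:: 0; 3; 2; 1]];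
  [:: [:: 0; 2; 1; 3]];
  [:: [:: 3; 0; 1; 2]; [:: 1; 2; 3; 0]];
  [:: [:: 1; 0; 2; 3]];
  [:: [:: 0; 1; 2; 3]]].

Definition state_class (p : seq nat) : nat := find (fun c => p \in c) state_classes.

(* For each class, the pairs (class of the next state, genus increment). *)
Definition class_moves : seq (seq (nat * nat)) := [::
  [:: (2, 0); (3, 0); (4, 0); (5, 0)];
  [:: (1, 0); (6, 0); (7, 0); (8, 0)];
  [:: (0, 1); (0, 1); (1, 1); (1, 1)];
  [:: (3, 0); (9, 0); (10, 0); (11, 0)];
  [:: (4, 0); (10, 0); (12, 0); (13, 0)];
  [:: (0, 1); (0, 1); (14, 1); (14, 1)];
  [:: (1, 1); (1, 1); (14, 1); (14, 1)];
  [:: (7, 0); (7, 0); (15, 0); (15, 0)];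
  [:: (1, 1); (1, 1); (14, 1); (14, 1)];
  [:: (3, 1); (3, 1); (3, 1); (3, 1)];
  [:: (10, 0); (10, 0); (16, 0); (16, 0)];
  [:: (3, 1); (3, 1); (3, 1); (3, 1)];
  [:: (4, 1); (4, 1); (4, 1); (4, 1)];
  [:: (4, 1); (4, 1); (4, 1); (4, 1)];
  [:: (6, 0); (7, 0); (8, 0); (14, 0)];
  [:: (7, 1); (7, 1); (7, 1); (7, 1)];
  [:: (10, 1); (10, 1); (10, 1); (10, 1)]].

Definition class_closings : seq (seq nat) := [::
  [:: 0; 0; 1; 1];
  [:: 1; 1; 1; 1];
  [:: 1; 1; 2; 2];
  [:: 1; 1; 2; 2];
  [:: 1; 1; 1; 1];
  [:: 0; 0; 1; 1];
  [:: 1; 1; 1; 1];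
  [:: 1; 1; 2; 2];
  [:: 1; 1; 2; 2];
  [:: 2; 2; 2; 2];
  [:: 2; 2; 2; 2];
  [:: 1; 1; 2; 2];
  [:: 2; 2; 2; 2];
  [:: 1; 1; 1; 1];
  [:: 0; 0; 1; 1];
  [:: 2; 2; 2; 2];
  [:: 2; 2; 2; 2]].

(** The partition is compatible with the transfer matrix: the moves of a state depend on its class
    alone, up to the order of the four bit pairs, which a sum over [bit_pairs] does not see. *)
Lemma class_moves_ok : all (fun p => (state_class p < 17) &&
  perm_eq [seq (state_class (next_state p x), next_genus p x) | x <- bit_pairs]
          (nth [::] class_moves (state_class p))) states.
Proof. by vm_compute. Qed.

Lemma class_closings_ok : all (fun p =>
  perm_eq [seq closing_genus p x | x <- bit_pairs]
          (nth [::] class_closings (state_class p))) states.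
Proof. by vm_compute. Qed.

Lemma next_state_in p x : p \in states -> next_state p x \in states.
Proof.
move=> pst; have := allP (allP next_ok _ pst) _ (mem_bit_pairs x).
by case: (glue_all _ _ _) => [[lv f] k] /and4P[].
Qed.

Lemma start_state_in x : start_state x \in states.
Proof.
have := allP start_ok _ (mem_bit_pairs x).
by case: (glue_all _ _ _) => [[lv f] k] /and4P[].
Qed.

Section GenusPolynomials.
Local Open Scope ring_scope.

Fixpoint genus_poly r p : {poly int} :=
  if r is r'.+1 then
    \sum_(x <- bit_pairs) 'X^(next_genus p x) * genus_poly r' (next_state p x)
  else \sum_(x <- bit_pairs) 'X^(closing_genus p x).

Lemma genus_polyS r p : genus_poly r.+1 p =
  \sum_(x <- bit_pairs) 'X^(next_genus p x) * genus_poly r (next_state p x).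
Proof. by []. Qed.

Lemma sum_run r p : \sum_(w <- words r.+1) 'X^(run p w) = genus_poly r p.
Proof.
elim: r p => [|r IH] p.
  rewrite big_allpairs_dep; apply: eq_bigr => x _; by rewrite big_seq1.
rewrite -[words r.+2]/[seq x :: w | x <- bit_pairs, w <- words r.+1] big_allpairs_dep.
rewrite [RHS]/=; apply: eq_bigr => x _; rewrite -IH big_distrr.
apply: eq_big_seq => w; rewrite mem_words => /eqP szw.
by rewrite run_cons ?szw // exprD.
Qed.

(** m counts the rungs after the first one: this is the genus polynomial of R_(m+1). *)
Definition cross_poly m : {poly int} :=
  \sum_(x <- bit_pairs) genus_poly m (start_state x).

Lemma embeddings_of_genus_cross m i :
  (embeddings_of_genus (cross m.+1) i)%:Z = (cross_poly m)`_i.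
Proof.
have -> : cross_poly m = \sum_(v <- words m.+2)
    'X^(run (start_state (head (false, false) v)) (behead v)).
  rewrite -[words m.+2]/[seq x :: w | x <- bit_pairs, w <- words m.+1] big_allpairs_dep.
  by apply: eq_bigr => x _; rewrite -sum_run.
rewrite embeddings_of_genus_words coef_sum -sum1_count big_mkcond -natz natr_sum.
apply: eq_big_seq => v; rewrite mem_words => /eqP szv.
by rewrite genus_rotation // coefXn eq_sym; case: eqP.
Qed.

(** * Closed form of the genus polynomials *)

Fixpoint lucas (R : pzSemiRingType) (c d : R) (k : nat) : R :=
  match k with
  | 0 => 1
  | k'.+1 => if k' is k''.+1 then c * lucas c d k' + d * lucas c d k'' else c
  end.

(** [lucas c d k] weighs the tilings of a strip of length k by squares of weight c and dominoes of
    weight d; a tiling with i dominoes has k - i tiles, whence the binomial coefficient. If k < 2i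
    the truncated exponent is harmless, since that coefficient is 0. *)
Lemma coef_lucas (c d k i : nat) :
  (lucas c%:R (d%:R * 'X : {poly int}) k)`_i
    = ('C(k - i, i) * (c ^ (k - i.*2) * d ^ i))%:Z.
Proof.
elim/ltn_ind: k i => -[|[|k]] IH i.
- rewrite sub0n bin0n /= coef1; case: i => [|i] //=.
- rewrite /= -[c%:R]mulr1 mulr_natl coefMn coef1.
  case: i => [|i]; first by rewrite bin0 mul1n muln1 expn1 natz.
  by rewrite mul0rn bin_small //; lia.
have -> : lucas c%:R (d%:R * 'X : {poly int}) k.+2 = c%:R * lucas c%:R (d%:R * 'X) k.+1
    + d%:R * (lucas c%:R (d%:R * 'X) k * 'X) by rewrite /=; ring.
move: (IH k.+1 (ltnSn _) i) (IH k (ltnW (ltnSn _)) i.-1).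
move: (lucas _ _ k.+1) (lucas _ _ k) => u v Eu Ev {IH}.
rewrite coefD !mulr_natl !coefMn coefMX Eu Ev.
case: i {Eu Ev} => [|i].
  by rewrite mul0rn addr0 !subn0 !bin0 !muln1 !mul1n -mulr_natl natz -PoszM -expnS.
rewrite -[_ *+ c]mulr_natl -[_ *+ d]mulr_natl !natz -!PoszM -PoszD; congr Posz.
rewrite [i.+1.-1]/=.
have [lt_ki|le_ik] := ltnP k i.
  by rewrite !bin_small ?mul0n ?muln0 //; lia.
have -> : (k.+2 - i.+1 = (k.+1 - i.+1).+1)%N by lia.
have -> : (k.+1 - i.+1 = k - i)%N by lia.
have -> : (k.+2 - i.+1.*2 = k - i.*2)%N by lia.
rewrite binS expnS; have [le_k2i|lt_2ik] := leqP k i.*2.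
  by rewrite (@bin_small (k - i) i.+1); [ring | lia].
have -> : (k - i.*2 = (k.+1 - i.+1.*2).+1)%N by lia.
rewrite !expnS; ring.
Qed.

(* The coefficients were found by interpolation; the formulas need at least one rung. *)
Definition class_poly (R : comPzRingType) (c : nat) (z e e' a a' b b' : R) : R :=
  match c with
  | 0 => 2 * e + (2 - 6 * z) * e' + (2 * z^+2) * a + (16 * z^+2) * a'
      + (2 * z - 2 * z^+2) * b + (14 * z - 14 * z^+2) * b'
  | 1 => (- 1 + z) + (2 * z + 2 * z^+2) * a + (8 * z^+2) * a' + (1 + z - 2 * z^+2) * b
      + (6 * z - 6 * z^+2) * b'
  | 2 => (- 2 * z + 2 * z^+2) + (1 - 3 * z) * e + (4 * z) * e' + (6 * z^+2) * a
      + (- 8 * z^+2 + 8 * z^+3) * a' + (5 * z - 5 * z^+2) * b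
      + (- 3 * z + 11 * z^+2 - 8 * z^+3) * b'
  | 3 => (4 * z^+2) * a + (8 * z^+2) * a' + (2 * z - 2 * z^+2) * b + (2 * z - 2 * z^+2) * b'
  | 4 => (4 * z^+2) * a + (8 * z^+2) * a' + (4 * z - 4 * z^+2) * b + (4 * z - 4 * z^+2) * b'
  | 5 => (2 * z - 2 * z^+2) + (1 - 3 * z) * e + (4 * z) * e' + (6 * z^+2) * a
      + (- 8 * z^+2 + 8 * z^+3) * a' + (5 * z - 5 * z^+2) * b
      + (- 3 * z + 11 * z^+2 - 8 * z^+3) * b'
  | 6 => (4 * z^+2) * a + (8 * z^+3) * a' + (3 * z - 3 * z^+2) * b
      + (z + 7 * z^+2 - 8 * z^+3) * b'
  | 7 => (2 * z + 2 * z^+2) * a + (8 * z^+2) * a'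
  | 8 => (4 * z^+2) * a + (8 * z^+3) * a' + (3 * z - 3 * z^+2) * b
      + (z + 7 * z^+2 - 8 * z^+3) * b'
  | 9 => (4 * z^+2) * a + (- 8 * z^+2 + 16 * z^+3) * a' + (z - z^+2) * b
      + (- z + 9 * z^+2 - 8 * z^+3) * b'
  | 10 => (4 * z^+2) * a + (8 * z^+2) * a'
  | 11 => (4 * z^+2) * a + (- 8 * z^+2 + 16 * z^+3) * a' + (z - z^+2) * b
      + (- z + 9 * z^+2 - 8 * z^+3) * b'
  | 12 => (4 * z^+2) * a + (- 8 * z^+2 + 16 * z^+3) * a' + (2 * z - 2 * z^+2) * b
      + (- 2 * z + 18 * z^+2 - 16 * z^+3) * b'
  | 13 => (4 * z^+2) * a + (- 8 * z^+2 + 16 * z^+3) * a' + (2 * z - 2 * z^+2) * b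
      + (- 2 * z + 18 * z^+2 - 16 * z^+3) * b'
  | 14 => (1 - z) + (2 * z + 2 * z^+2) * a + (8 * z^+2) * a' + (1 + z - 2 * z^+2) * b
      + (6 * z - 6 * z^+2) * b'
  | 15 => (4 * z^+2) * a + (8 * z^+3) * a'
  | _ => (4 * z^+2) * a + (- 8 * z^+2 + 16 * z^+3) * a'
  end.

(** Once the Lucas recurrence is unfolded, the induction step is, for each of the 17 classes, a
    polynomial identity in z and six independent unknowns. *)
Lemma genus_poly_class r p : p \in states ->
  let L (c d : {poly int}) := lucas c d in let z : {poly int} := 'X in
  genus_poly r.+1 p = class_poly (state_class p) z
    (L 0 (4 * z) r.+1) (L 0 (4 * z) r) (L 2 (8 * z) r.+1) (L 2 (8 * z) r)
    (L 1 (8 * z) r.+1) (L 1 (8 * z) r).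
Proof.
move=> + L z; elim: r p => [|r IH] p pst.
  have /andP[lt17 moves] := allP class_moves_ok _ pst.
  have -> : genus_poly 1 p = \sum_(y <- nth [::] class_moves (state_class p))
     'X^(y.2) * \sum_(g <- nth [::] class_closings y.1) 'X^g.
    rewrite -(perm_big _ moves) big_map; apply: eq_bigr => x _.
    rewrite -(perm_big _ (allP class_closings_ok _ (next_state_in x pst))).
    by rewrite big_map.
  rewrite -/z; move: (state_class p) lt17 => c.
  do 17?[case: c => [_|c]]; rewrite /= ?big_cons ?big_nil /= ?expr0 ?expr1 -?/z //; try ring.
have /andP[lt17 moves] := allP class_moves_ok _ pst.
have -> : genus_poly r.+2 p = \sum_(y <- nth [::] class_moves (state_class p))
   'X^(y.2) * class_poly y.1 z
    (L 0 (4 * z) r.+1) (L 0 (4 * z) r) (L 2 (8 * z) r.+1) (L 2 (8 * z) r)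
    (L 1 (8 * z) r.+1) (L 1 (8 * z) r).
  rewrite -(perm_big _ moves) big_map genus_polyS; apply: eq_bigr => x _.
  by rewrite IH // next_state_in.
have LS c d : L c d r.+2 = c * L c d r.+1 + d * L c d r by [].
rewrite !LS; move: (L 0 _ r.+1) (L 0 _ r) (L 2 _ r.+1) (L 2 _ r) (L 1 _ r.+1) (L 1 _ r).
move=> e e' a a' b b'; rewrite -/z; move: (state_class p) lt17 => c.
do 17?[case: c => [_|c]]; rewrite /= ?big_cons ?big_nil /= ?expr0 ?expr1 -?/z //; try ring.
Qed.

Lemma cross_polyE r :
  let L (c d : {poly int}) := lucas c d in let z : {poly int} := 'X in
  cross_poly r.+1 =
    4 * L 0 (4 * z) r.+1 + 4 * L 0 (4 * z) r + 2 * L 1 (8 * z) r.+1 - 2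
    + (2 + 4 * L 2 (8 * z) r.+1 + 6 * L 1 (8 * z) r.+1 + 40 * L 1 (8 * z) r
       - 12 * L 0 (4 * z) r) * z
    + (8 * L 2 (8 * z) r.+1 + 48 * L 2 (8 * z) r - 8 * L 1 (8 * z) r.+1
       - 40 * L 1 (8 * z) r) * z * z.
Proof.
move=> L z; rewrite /cross_poly.
under eq_bigr do rewrite genus_poly_class ?start_state_in // -/z -/L.
rewrite -(big_map (fun x => state_class (start_state x)) xpredT
  (fun c => class_poly c z (L 0 (4 * z) r.+1) (L 0 (4 * z) r) (L 2 (8 * z) r.+1)
              (L 2 (8 * z) r) (L 1 (8 * z) r.+1) (L 1 (8 * z) r))).
have -> : [seq state_class (start_state x) | x <- bit_pairs] = [:: 0; 1; 1; 0]%N.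
  by vm_compute.
rewrite !big_cons big_nil /=; ring.
Qed.

Definition lucas_coef (c d k i : nat) : nat := 'C(k - i, i) * (c ^ (k - i.*2) * d ^ i).

(** The index is shifted: for k > 0 this is the coefficient of z ^ (j + 1), the number of embeddings
    of R_(k+1) of genus j + 1. The dominant binomial coefficients then have lower index near j. *)
Definition cross_coef (k j : nat) : int :=
  let E k i := (lucas_coef 0 4 k i)%:Z in let A k i := (lucas_coef 2 8 k i)%:Z in
  let B k i := (lucas_coef 1 8 k i)%:Z in
  4 * E k j.+1 + 4 * E k.-1 j.+1 + 2 * B k j.+1
  + ((j == 0%N)%:R * 2 + 4 * A k j + 6 * B k j + 40 * B k.-1 j - 12 * E k.-1 j)
  + if j is j'.+1 then 8 * A k j' + 48 * A k.-1 j' - 8 * B k j' - 40 * B k.-1 j' else 0.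

Lemma cross_coefE k j : (0 < k)%N -> (cross_poly k)`_j.+1 = cross_coef k j.
Proof.
case: k => // r _; rewrite cross_polyE.
have coefL c d k i : (lucas c%:R (d%:R * 'X : {poly int}) k)`_i = (lucas_coef c d k i)%:Z.
  exact: coef_lucas.
have EL k i : (lucas 0 (4 * 'X : {poly int}) k)`_i = (lucas_coef 0 4 k i)%:Z := coefL 0 4 k i.
have AL k i : (lucas 2 (8 * 'X : {poly int}) k)`_i = (lucas_coef 2 8 k i)%:Z := coefL 2 8 k i.
have BL k i : (lucas 1 (8 * 'X : {poly int}) k)`_i = (lucas_coef 1 8 k i)%:Z := coefL 1 8 k i.
move: (EL r.+1) (EL r) (AL r.+1) (AL r) (BL r.+1) (BL r); rewrite /cross_coef [r.+1.-1]/=.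
move: (lucas _ _ _) (lucas _ _ _) (lucas _ _ _) (lucas _ _ _) (lucas _ _ _) (lucas _ _ _).
move=> e e' a a' b b' Ee Ee' Ea Ea' Eb Eb'.
have coef_nat c (p : {poly int}) i : (c%:R * p)`_i = c%:R * p`_i.
  by rewrite !mulr_natl coefMn.
rewrite !(coefD, coefN, coefMX, coef_nat, coef1) !Ee !Ee' !Eb !Eb' !Ea !Ea'.
by case: j => [|j]; rewrite /= ?Ea ?Ea' ?Eb ?Eb' /=; ring.
Qed.

(** With at least three rungs the cross is not planar: the sequences with c = 0 have constant term
    0, and the constant 2 of the sequence with c = 1 cancels against -2. *)
Lemma coef0_cross_poly k : (1 < k)%N -> (cross_poly k)`_0 = 0.
Proof.
case: k => // r lt0r; rewrite cross_polyE.
have := coef_lucas 0 4 r.+1 0; have := coef_lucas 0 4 r 0; have := coef_lucas 1 8 r.+1 0.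
rewrite !subn0 !bin0 !exp1n !expn0 !exp0n //.
move: (lucas _ _ _) (lucas _ _ _) (lucas _ _ _) (lucas _ _ _) (lucas _ _ _) (lucas _ _ _).
move=> b e' e u v w Eb Ee' Ee.
have coef_nat c (p : {poly int}) i : (c%:R * p)`_i = c%:R * p`_i.
  by rewrite !mulr_natl coefMn.
by rewrite !(coefD, coefN, coefMX, coef_nat, coef1) Eb Ee Ee'.
Qed.

Lemma cross_coef_eq0 k j : (0 < k)%N -> (k < j.*2)%N -> cross_coef k j.+1 = 0.
Proof.
move=> k0 ltkj; have z c d l i : (l < i.*2)%N -> lucas_coef c d l i = 0%N.
  by move=> lt; rewrite /lucas_coef bin_small //; lia.
by rewrite /cross_coef !z //; lia.
Qed.

End GenusPolynomials.

(** * Differences of consecutive genus numbers *)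

Section SlopePolynomials.
Local Open Scope Z_scope.

(* Where [growth] and [perturbation] come from: divided by 8 ^ j, the difference of two
   consecutive genus numbers is 2 ^ b times one combination of binomial coefficients
   plus another one (see [slope]), and every binomial coefficient involved is
   (b + j - 1)! / ((b + 2)! (j + 1)!) times a polynomial in b and j. *)
Definition growth (b j : Z) : Z :=
  8 * ((b + 2) * (b + 1) * b * (b - 1)) + 4 * ((b + j) * (j + 1) * (b + 2) * (b + 1))
  + 24 * ((j + 1) * (b + 2) * (b + 1) * b) - 4 * ((b + j + 1) * (b + j) * (j + 1) * j)
  - 12 * ((b + j) * (j + 1) * j * (b + 2)).

Definition perturbation (w b j : Z) : Z :=
  w * ((b + 2) * (b + 1) * b * (b - 1)) - 14 * ((b + j) * (j + 1) * (b + 2) * (b + 1))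
  - 80 * ((j + 1) * (b + 2) * (b + 1) * b) + (b + j + 1) * (b + j) * (j + 1) * j
  + 5 * ((b + j) * (j + 1) * j * (b + 2)).

Ltac Z_positivity :=
  repeat (first [apply Z.add_nonneg_pos | apply Z.add_nonneg_nonneg
                | apply Z.mul_nonneg_nonneg | apply Z.pow_nonneg]); try lia.

(** Here b = 4 + x + y and j = 4 + x parametrise b >= j >= 4, and t stands for 2 ^ b = 16 * 2 ^ (b -
    4), at least 16 (b - 3). Since [growth] is nonnegative there, t may be replaced by this bound;
    the resulting polynomial in x and y has nonnegative coefficients and a positive constant
    term. *)
Lemma slope_inc_large t x y : 0 <= x -> 0 <= y -> 16 * (1 + x + y) <= t ->
  0 < t * growth (4 + x + y) (4 + x) + perturbation 32 (4 + x + y) (4 + x).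
Proof.
intros x0 y0 le_t; assert (0 <= growth (4 + x + y) (4 + x)) as growth0.
  replace (growth _ _) with
    (72 * x^3 * y + 48 * x^3 + 120 * x^2 * y^2 + 1104 * x^2 * y + 672 * x^2 + 60 * x * y^3
     + 1164 * x * y^2 + 5568 * x * y + 3120 * x + 8 * y^4 + 284 * y^3 + 2812 * y^2
     + 9256 * y + 4800)
    by (unfold growth; Z_ring).
  Z_positivity.
apply Z.lt_le_trans with (16 * (1 + x + y) * growth (4 + x + y) (4 + x)
  + perturbation 32 (4 + x + y) (4 + x)); [|nia].
replace (_ + _) with
  (1152 * x^4 * y + 706 * x^4 + 3072 * x^3 * y^2 + 19421 * x^3 * y + 10196 * x^3
   + 2880 * x^2 * y^3 + 38110 * x^2 * y^2 + 114854 * x^2 * y + 50186 * x^2 + 1088 * x * y^4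
   + 24162 * x * y^3 + 151540 * x * y^2 + 272881 * x * y + 90232 * x + 128 * y^5
   + 4704 * y^4 + 49642 * y^3 + 189686 * y^2 + 199720 * y + 29760)
  by (unfold growth, perturbation; Z_ring).
Z_positivity.
Qed.

(** For j = 0, 1, 2, 3 the region starts at b = 4 instead of b = j, so each of these values gets its
    own polynomial in x = b - 4. *)
Lemma slope_inc0 t x : 0 <= x -> 16 * (1 + x) <= t ->
  0 < t * growth (4 + x) 0 + perturbation 32 (4 + x) 0.
Proof.
intros x0 le_t; assert (0 <= growth (4 + x) 0) as growth0.
  replace (growth _ _) with
    (8 * x^4 + 172 * x^3 + 1372 * x^2 + 4808 * x + 6240)
    by (unfold growth; Z_ring).
  Z_positivity.
apply Z.lt_le_trans with (16 * (1 + x) * growth (4 + x) 0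
  + perturbation 32 (4 + x) 0); [|nia].
replace (_ + _) with
  (128 * x^5 + 2912 * x^4 + 25186 * x^3 + 101278 * x^2 + 180756 * x + 100080)
  by (unfold growth, perturbation; Z_ring).
Z_positivity.
Qed.

Lemma slope_inc1 t x : 0 <= x -> 16 * (1 + x) <= t ->
  0 < t * growth (4 + x) 1 + perturbation 32 (4 + x) 1.
Proof.
intros x0 le_t; assert (0 <= growth (4 + x) 1) as growth0.
  replace (growth _ _) with
    (8 * x^4 + 200 * x^3 + 1768 * x^2 + 6616 * x + 8880)
    by (unfold growth; Z_ring).
  Z_positivity.
apply Z.lt_le_trans with (16 * (1 + x) * growth (4 + x) 1
  + perturbation 32 (4 + x) 1); [|nia].
replace (_ + _) with
  (128 * x^5 + 3360 * x^4 + 31876 * x^3 + 135116 * x^2 + 244792 * x + 130560)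
  by (unfold growth, perturbation; Z_ring).
Z_positivity.
Qed.

Lemma slope_inc2 t x : 0 <= x -> 16 * (1 + x) <= t ->
  0 < t * growth (4 + x) 2 + perturbation 32 (4 + x) 2.
Proof.
intros x0 le_t; assert (0 <= growth (4 + x) 2) as growth0.
  replace (growth _ _) with
    (8 * x^4 + 228 * x^3 + 2140 * x^2 + 8040 * x + 10080)
    by (unfold growth; Z_ring).
  Z_positivity.
apply Z.lt_le_trans with (16 * (1 + x) * growth (4 + x) 2
  + perturbation 32 (4 + x) 2); [|nia].
replace (_ + _) with
  (128 * x^5 + 3808 * x^4 + 38182 * x^3 + 162410 * x^2 + 279510 * x + 137772)
  by (unfold growth, perturbation; Z_ring).
Z_positivity.
Qed.

Lemma slope_inc3 t x : 0 <= x -> 16 * (1 + x) <= t ->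
  0 < t * growth (4 + x) 3 + perturbation 32 (4 + x) 3.
Proof.
intros x0 le_t; assert (0 <= growth (4 + x) 3) as growth0.
  replace (growth _ _) with
    (8 * x^4 + 256 * x^3 + 2488 * x^2 + 8960 * x + 9024)
    by (unfold growth; Z_ring).
  Z_positivity.
apply Z.lt_le_trans with (16 * (1 + x) * growth (4 + x) 3
  + perturbation 32 (4 + x) 3); [|nia].
replace (_ + _) with
  (128 * x^5 + 4256 * x^4 + 44104 * x^3 + 181240 * x^2 + 269976 * x + 108936)
  by (unfold growth, perturbation; Z_ring).
Z_positivity.
Qed.

(** The mirror case j > b >= 3, with b = 3 + x and j = 4 + x + y: [growth] is now nonpositive, and
    the lower bound 8 (b - 2) on 2 ^ b again goes in the right direction. *)
Lemma slope_dec_large t x y : 0 <= x -> 0 <= y -> 8 * (1 + x) <= t ->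
  t * growth (3 + x) (4 + x + y) + perturbation 256 (3 + x) (4 + x + y) < 0.
Proof.
intros x0 y0 le_t; assert (0 <= - growth (3 + x) (4 + x + y)) as growth0.
  replace (- _) with
    (72 * x^3 * y + 24 * x^3 + 96 * x^2 * y^2 + 936 * x^2 * y + 312 * x^2 + 36 * x * y^3
     + 816 * x * y^2 + 4044 * x * y + 1344 * x + 4 * y^4 + 156 * y^3 + 1724 * y^2 + 5796 * y
     + 1920)
    by (unfold growth; Z_ring).
  Z_positivity.
apply Z.le_lt_trans with (8 * (1 + x) * growth (3 + x) (4 + x + y)
  + perturbation 256 (3 + x) (4 + x + y)); [nia|].
apply Z.opp_pos_neg.
replace (- _) with
  (576 * x^4 * y + 30 * x^4 + 768 * x^3 * y^2 + 8149 * x^3 * y + 713 * x^3 + 288 * x^2 * y^3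
   + 7277 * x^2 * y^2 + 40869 * x^2 * y + 5278 * x^2 + 32 * x * y^4 + 1525 * x * y^3
   + 20161 * x * y^2 + 82795 * x * y + 15079 * x + 31 * y^4 + 1199 * y^3 + 13461 * y^2
   + 51649 * y + 13820)
  by (unfold growth, perturbation; Z_ring).
Z_positivity.
Qed.

(** For b = 0, 1, 2 the exact value of 2 ^ b is inserted instead of a bound. *)
Lemma slope_dec0 y : 0 <= y ->
  1 * growth 0 (1 + y) + perturbation 256 0 (1 + y) < 0.
Proof.
intros y0; apply Z.opp_pos_neg.
replace (- _) with
  (3 * y^4 + 32 * y^3 + 115 * y^2 + 166 * y + 80)
  by (unfold growth, perturbation; Z_ring).
Z_positivity.
Qed.

Lemma slope_dec1 y : 0 <= y ->
  2 * growth 1 (2 + y) + perturbation 256 1 (2 + y) < 0.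
Proof.
intros y0; apply Z.opp_pos_neg.
replace (- _) with
  (7 * y^4 + 141 * y^3 + 863 * y^2 + 2319 * y + 2430)
  by (unfold growth, perturbation; Z_ring).
Z_positivity.
Qed.

Lemma slope_dec2 y : 0 <= y ->
  4 * growth 2 (3 + y) + perturbation 256 2 (3 + y) < 0.
Proof.
intros y0; apply Z.opp_pos_neg.
replace (- _) with
  (15 * y^4 + 442 * y^3 + 3825 * y^2 + 12614 * y + 6792)
  by (unfold growth, perturbation; Z_ring).
Z_positivity.
Qed.

Lemma slope_combination t w b j c1 c2 c3 c4 c5 u v :
  c1 * v = u * ((b + 2) * (b + 1) * b * (b - 1)) ->
  c2 * v = (b + j) * u * ((j + 1) * ((b + 2) * (b + 1))) ->
  c3 * v = u * ((j + 1) * ((b + 2) * (b + 1) * b)) ->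
  c4 * v = (b + j + 1) * ((b + j) * u) * ((j + 1) * j) ->
  c5 * v = (b + j) * u * ((j + 1) * j * (b + 2)) ->
  (t * (8 * c1 + 4 * c2 + 24 * c3 - 4 * c4 - 12 * c5)
   + (w * c1 - 14 * c2 - 80 * c3 + c4 + 5 * c5)) * v
  = u * (t * growth b j + perturbation w b j).
Proof.
intros h1 h2 h3 h4 h5.
replace (_ * v) with
  (t * (8 * (c1 * v) + 4 * (c2 * v) + 24 * (c3 * v) - 4 * (c4 * v) - 12 * (c5 * v))
   + (w * (c1 * v) - 14 * (c2 * v) - 80 * (c3 * v) + c4 * v + 5 * (c5 * v))) by Z_ring.
rewrite h1 h2 h3 h4 h5; unfold growth, perturbation; Z_ring.
Qed.

End SlopePolynomials.

(** * The sign of the slope *)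

Section Slope.
Local Open Scope Z_scope.

(** Brings binomial coefficients with different indices to a common denominator, which is (j + 1)!
    (b + 2)! with k + t = j + 1 and R = b + 2. For k > N both sides vanish, as then s > R. *)
Lemma bin_ffact_scale N k R t s : (R + k = N + s)%N ->
  ('C(N, k) * ((k + t)`! * R`!) = N`! * ((k + t) ^_ t * R ^_ s))%N.
Proof.
move=> e; have [le_kN|lt_Nk] := leqP k N; last first.
  by rewrite bin_small // [(R ^_ s)%N]ffact_small ?muln0 //; lia.
have le_sR : (s <= R)%N by lia.
rewrite -(ffact_fact le_sR) -(ffact_fact (leq_addl k t)) addnK.
have -> : (R - s = N - k)%N by lia.
rewrite -(bin_fact le_kN); ring.
Qed.

Lemma Z_of_natM x y : Z.of_nat (x * y)%N = Z.of_nat x * Z.of_nat y.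
Proof. lia. Qed.

Fixpoint falling (x : Z) (s : nat) : Z :=
  if s is s'.+1 then falling x s' * (x - Z.of_nat s') else 1.

Lemma ffactZ n s : Z.of_nat (n ^_ s)%N = falling (Z.of_nat n) s.
Proof.
elim: s => //= s <-; rewrite ffactnSr.
have [le_sn|lt_ns] := leqP s n; last by rewrite ffact_small.
by rewrite Z_of_natM; congr (_ * _); lia.
Qed.

(* 'C(N, j - 1), with the value 0 at j = 0. *)
Definition bin_pred N j := if j is j'.+1 then 'C(N, j') else 0%N.

Definition slope_part (w : Z) (b j : nat) : Z :=
  let a := (b + j)%N in
  let c1 := Z.of_nat 'C(a.-1, j.+1) in let c2 := Z.of_nat 'C(a, j) in
  let c3 := Z.of_nat 'C(a.-1, j) in let c4 := Z.of_nat (bin_pred a.+1 j) in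
  let c5 := Z.of_nat (bin_pred a j) in
  Z.of_nat (2 ^ b)%N * (8 * c1 + 4 * c2 + 24 * c3 - 4 * c4 - 12 * c5)
  + (w * c1 - 14 * c2 - 80 * c3 + c4 + 5 * c5).

(** The last two binomial coefficients have upper index b + j - 2 and are kept apart from the common
    factor of [slope_part]. Being nonnegative, they are dropped in the lower bound; in the upper
    bound they are absorbed by a larger weight [w]. *)
Definition slope (b j : nat) : Z :=
  slope_part 32 b j
  + 128 * Z.of_nat 'C((b + j).-2, j.+2) + 320 * Z.of_nat 'C((b + j).-2, j.+1).

Lemma slope_partE w b j : (0 < b + j)%N ->
  slope_part w b j * Z.of_nat (b.+2`! * j.+1`!)%N
  = Z.of_nat ((b + j).-1)`! * (Z.of_nat (2 ^ b)%N * growth (Z.of_nat b) (Z.of_nat j)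
                             + perturbation w (Z.of_nat b) (Z.of_nat j)).
Proof.
case ea: (b + j)%N => [|a'] // _; rewrite /slope_part ea [a'.+1.-1]/=.
set v := Z.of_nat (b.+2`! * j.+1`!)%N.
have scale N k t s : (k + t = j.+1)%N -> (b.+2 + k = N + s)%N ->
    Z.of_nat 'C(N, k) * v
    = Z.of_nat N`! * (falling (Z.of_nat j.+1) t * falling (Z.of_nat b.+2) s).
  move=> ekt eN; have := congr1 Z.of_nat (bin_ffact_scale t eN).
  rewrite ekt (Z_of_natM 'C(N, k)) (Z_of_natM N`!) (Z_of_natM (_ ^_ _)).
  rewrite -!ffactZ [(j.+1`! * _)%N]mulnC.
  exact: id.
have scale_pred N t s : (j + t = j.+2)%N -> (b.+2 + j = N.+1 + s)%N ->
    Z.of_nat (bin_pred N j) * v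
    = Z.of_nat N`! * (falling (Z.of_nat j.+1) t * falling (Z.of_nat b.+2) s).
  case: (j) scale => [|k] scale ekt eN.
    (* At j = 0 the value 0 of [bin_pred] agrees with the formula, because the falling factorial (j
       + 1) j on the right vanishes. *)
    have -> : t = 2%N by lia.
    by rewrite /= ; lia.
  by apply: scale; lia.
have ab : Z.of_nat a' + 1 = Z.of_nat b + Z.of_nat j by lia.
have {scale scale_pred} [h1 h2 h3 h4 h5] :
  [/\ Z.of_nat 'C(a', j.+1) * v
        = Z.of_nat a'`! * (falling (Z.of_nat j.+1) 0 * falling (Z.of_nat b.+2) 4),
      Z.of_nat 'C(a'.+1, j) * v
        = Z.of_nat (a'.+1)`! * (falling (Z.of_nat j.+1) 1 * falling (Z.of_nat b.+2) 2),
      Z.of_nat 'C(a', j) * v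
        = Z.of_nat a'`! * (falling (Z.of_nat j.+1) 1 * falling (Z.of_nat b.+2) 3),
      Z.of_nat (bin_pred a'.+2 j) * v
        = Z.of_nat (a'.+2)`! * (falling (Z.of_nat j.+1) 2 * falling (Z.of_nat b.+2) 0)
    & Z.of_nat (bin_pred a'.+1 j) * v
        = Z.of_nat (a'.+1)`! * (falling (Z.of_nat j.+1) 2 * falling (Z.of_nat b.+2) 1)].
  by split; [apply: scale | apply: scale | apply: scale
            | apply: scale_pred | apply: scale_pred]; lia.
move: h1 h2 h3 h4 h5; rewrite [a'.+2`!]factS [a'.+1`!]factS.
rewrite !(Z_of_natM a'.+2) !(Z_of_natM a'.+1).
have -> : Z.of_nat a'.+2 = Z.of_nat b + Z.of_nat j + 1 by lia.
have -> : Z.of_nat a'.+1 = Z.of_nat b + Z.of_nat j by lia.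
have -> : Z.of_nat b.+2 = Z.of_nat b + 2 by lia.
have -> : Z.of_nat j.+1 = Z.of_nat j + 1 by lia.
move: (Z.of_nat b) (Z.of_nat j) => B J.
have falling1 x : falling x 1 = x by rewrite /falling; lia.
have falling2 x : falling (x + 1) 2 = (x + 1) * x by rewrite /falling; lia.
have falling2' x : falling (x + 2) 2 = (x + 2) * (x + 1) by rewrite /falling; lia.
have falling3 x : falling (x + 2) 3 = (x + 2) * (x + 1) * x.
  by rewrite -falling2' /falling; lia.
have falling4 x : falling (x + 2) 4 = (x + 2) * (x + 1) * x * (x - 1).
  by rewrite -falling3 [LHS]/=; congr (_ * _); lia.
rewrite !falling4 !falling3 !falling2' !falling2 !falling1 /falling.
rewrite !Z.mul_1_l !Z.mul_1_r; exact: slope_combination.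
Qed.

Lemma expn2_ge s : (s.+1 <= 2 ^ s)%N.
Proof. exact: ltn_expl. Qed.

Lemma slope_part_inc b j : (4 <= b)%N -> (j <= b)%N -> 0 < slope_part 32 b j.
Proof.
move=> le4b lejb; have pos : (0 < b + j)%N by lia.
have := slope_partE 32 pos; move: (slope_part _ _ _) => S.
have fact_pos k : 0 < Z.of_nat k`! by have := fact_gt0 k; lia.
have v_pos : 0 < Z.of_nat (b.+2`! * j.+1`!)%N by rewrite Z_of_natM; apply: Z.mul_pos_pos.
have u_pos := fact_pos (b + j).-1.
move: u_pos v_pos; move: (Z.of_nat _`!) (Z.of_nat (_ * _)%N) => u v u0 v0.
set X := _ + perturbation _ _ _; suff : 0 < X by nia.
have [s es] : exists s, b = (4 + s)%N by exists (b - 4)%N; lia.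
have le_t : 16 * (1 + Z.of_nat s) <= Z.of_nat (2 ^ b)%N.
  by rewrite es expnD; have := expn2_ge s; lia.
rewrite /X; have -> : Z.of_nat b = 4 + Z.of_nat s by lia.
case: j lejb @X {pos} => [|[|[|[|x]]]] lejb X.
- by apply: slope_inc0 => //; lia.
- by apply: slope_inc1 => //; lia.
- by apply: slope_inc2 => //; lia.
- by apply: slope_inc3 => //; lia.
have -> : Z.of_nat x.+4 = 4 + Z.of_nat x by lia.
have -> : 4 + Z.of_nat s = 4 + Z.of_nat x + Z.of_nat (s - x)%N by lia.
by apply: slope_inc_large; lia.
Qed.

Lemma slope_inc b j : (4 <= b)%N -> (j <= b)%N -> 0 < slope b j.
Proof. by move=> le4b lejb; have := slope_part_inc le4b lejb; rewrite /slope; lia. Qed.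

Lemma slope_part_dec b j : (b < j)%N -> slope_part 256 b j < 0.
Proof.
move=> ltbj; have pos : (0 < b + j)%N by lia.
have := slope_partE 256 pos; move: (slope_part _ _ _) => S.
have fact_pos k : 0 < Z.of_nat k`! by have := fact_gt0 k; lia.
have v_pos : 0 < Z.of_nat (b.+2`! * j.+1`!)%N by rewrite Z_of_natM; apply: Z.mul_pos_pos.
have u_pos := fact_pos (b + j).-1.
move: u_pos v_pos; move: (Z.of_nat _`!) (Z.of_nat (_ * _)%N) => u v u0 v0.
set X := _ + perturbation _ _ _; suff : X < 0 by nia.
have [y ej] : exists y, j = (b.+1 + y)%N by exists (j - b.+1)%N; lia.
case: b ltbj @X {pos} ej => [|[|[|x]]] ltbj X ej; rewrite /X.
- have -> : Z.of_nat j = 1 + Z.of_nat y by lia.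
  by apply: slope_dec0; lia.
- have -> : Z.of_nat j = 2 + Z.of_nat y by lia.
  by apply: slope_dec1; lia.
- have -> : Z.of_nat j = 3 + Z.of_nat y by lia.
  by apply: slope_dec2; lia.
have -> : Z.of_nat j = 4 + Z.of_nat x + Z.of_nat y by lia.
have -> : Z.of_nat x.+3 = 3 + Z.of_nat x by lia.
apply: slope_dec_large; [lia | lia | ].
by rewrite -[x.+3]/(3 + x)%N expnD; have := expn2_ge x; lia.
Qed.

(* For b < j the two last binomial coefficients of [slope] are at most half of
   'C(b + j - 1, j + 1), whence the weight 256 = 32 + 128 / 2 + 320 / 2. *)
Lemma slope_dec b j : (b < j)%N -> (1 < b + j)%N -> slope b j < 0.
Proof.
move=> ltbj pos; have := slope_part_dec ltbj.
have c7 := mul_bin_down (b + j).-1 j.+1.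
have c6 := mul_bin_left (b + j).-2 j.+1.
suff [le7 le6] : (2 * 'C((b + j).-2, j.+1) <= 'C((b + j).-1, j.+1))%N
  /\ ('C((b + j).-2, j.+2) <= 'C((b + j).-2, j.+1))%N.
  by rewrite /slope /slope_part; move: (Z.of_nat (2 ^ b)%N * _) => X; lia.
split.
  rewrite -(@leq_pmul2l (b + j).-1); last by lia.
  by rewrite mulnCA c7 mulnA leq_mul2r; lia.
rewrite -(@leq_pmul2l j.+2) // c6 leq_mul2r; lia.
Qed.

End Slope.

(** * Differences of consecutive genus numbers in terms of the slope *)

Section Steps.
Variables b j : nat.
Hypothesis lt1 : 1 < b + j.
Let k := b + j.*2.

Local Open Scope Z_scope.

(** The contribution of the family x^2 = 4z: its k-th member is 4 ^ i z ^ i if k = 2i and 0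
    otherwise, so that it is felt only for b from 1 to 5. The -2 comes from the isolated term 2z of
    [cross_polyE]. *)
Definition boundary_term : Z :=
  match b with 1%N => 12 | 2%N => -16 | 3%N => -64 | 4%N | 5%N => 64 | _ => 0 end
  * Z.of_nat (4 ^ j)%N - match j with O => 2 | _ => 0 end.

Lemma cross_coef_step :
  Z_of_int (cross_coef k j.+1) = Z_of_int (cross_coef k j)
    + Z.of_nat (8 ^ j)%N * slope b j + boundary_term.
Proof.
Local Close Scope Z_scope.
set T := 2 ^ b; set P := 8 ^ j.
(* Each coefficient is written over P = 8 ^ j and T = 2 ^ b, after multiplication by a constant that
   clears denominators such as T / 4. Where the exponent of 2 would be negative, the binomial
   coefficient is 0. *)
have A1 : 4 * lucas_coef 2 8 k j.+1 = 8 * (P * T * 'C((b + j).-1, j.+1)).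
  rewrite /lucas_coef (_ : k - j.+1 = (b + j).-1); last by rewrite /k; lia.
  have [b2|b1] := leqP 2 b; last by rewrite bin_small ?mul0n ?muln0; lia.
  rewrite /T /P (_ : b = (k - j.+1.*2).+2); last by rewrite /k; lia.
  rewrite !expnS; ring.
have A2 : lucas_coef 2 8 k j = P * T * 'C(b + j, j).
  rewrite /lucas_coef (_ : k - j = b + j); last by rewrite /k; lia.
  rewrite (_ : k - j.*2 = b); last by rewrite /k; lia.
  by rewrite /P /T; ring.
have A3 : 2 * lucas_coef 2 8 k.-1 j = P * T * 'C((b + j).-1, j).
  rewrite /lucas_coef (_ : k.-1 - j = (b + j).-1); last by rewrite /k; lia.
  have [b0|b0] := posnP b; first by rewrite bin_small ?mul0n ?muln0; lia.
  rewrite /T /P (_ : b = (k.-1 - j.*2).+1); last by rewrite /k; lia.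
  rewrite !expnS; ring.
have A4 : 8 * (if j is i.+1 then lucas_coef 2 8 k i else 0) = 4 * (P * T * bin_pred (b + j).+1 j).
  rewrite /P /T /k; case: (j) => [|i]; first by rewrite !muln0.
  rewrite /lucas_coef /= (_ : b + i.+1.*2 - i = (b + i.+1).+1); last lia.
  rewrite (_ : b + i.+1.*2 - i.*2 = b.+2); last lia.
  rewrite !expnS; ring.
have A5 : 8 * (if j is i.+1 then lucas_coef 2 8 k.-1 i else 0) = 2 * (P * T * bin_pred (b + j) j).
  rewrite /P /T /k; case: (j) => [|i]; first by rewrite !muln0.
  rewrite /lucas_coef /= (_ : (b + i.+1.*2).-1 - i = b + i.+1); last lia.
  rewrite (_ : (b + i.+1.*2).-1 - i.*2 = b.+1); last lia.
  rewrite !expnS; ring.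
have B0 : lucas_coef 1 8 k j.+2 = 64 * (P * 'C((b + j).-2, j.+2)).
  rewrite /lucas_coef (_ : k - j.+2 = (b + j).-2); last by rewrite /k; lia.
  by rewrite /P exp1n !expnS; ring.
have B0' : lucas_coef 1 8 k.-1 j.+1 = 8 * (P * 'C((b + j).-2, j.+1)).
  rewrite /lucas_coef (_ : k.-1 - j.+1 = (b + j).-2); last by rewrite /k; lia.
  by rewrite /P exp1n !expnS; ring.
have B1 : lucas_coef 1 8 k j.+1 = 8 * (P * 'C((b + j).-1, j.+1)).
  rewrite /lucas_coef (_ : k - j.+1 = (b + j).-1); last by rewrite /k; lia.
  by rewrite /P exp1n !expnS; ring.
have B2 : lucas_coef 1 8 k j = P * 'C(b + j, j).
  rewrite /lucas_coef (_ : k - j = b + j); last by rewrite /k; lia.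
  by rewrite /P exp1n; ring.
have B3 : lucas_coef 1 8 k.-1 j = P * 'C((b + j).-1, j).
  rewrite /lucas_coef (_ : k.-1 - j = (b + j).-1); last by rewrite /k; lia.
  by rewrite /P exp1n; ring.
have B4 : 8 * (if j is i.+1 then lucas_coef 1 8 k i else 0) = P * bin_pred (b + j).+1 j.
  rewrite /P /k; case: (j) => [|i]; first by rewrite !muln0.
  rewrite /lucas_coef /= (_ : b + i.+1.*2 - i = (b + i.+1).+1); last lia.
  rewrite exp1n !expnS; ring.
have B5 : 8 * (if j is i.+1 then lucas_coef 1 8 k.-1 i else 0) = P * bin_pred (b + j) j.
  rewrite /P /k; case: (j) => [|i]; first by rewrite !muln0.
  rewrite /lucas_coef /= (_ : (b + i.+1.*2).-1 - i = b + i.+1); last lia.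
  rewrite exp1n !expnS; ring.
have E l i : lucas_coef 0 4 l i = (l == i.*2) * 4 ^ i.
  rewrite /lucas_coef; case: (ltngtP l i.*2) => [lt|gt|->].
  - by rewrite bin_small //; lia.
  - by rewrite exp0n ?mul0n ?muln0 //; lia.
  by rewrite subnn expn0 mul1n -addnn addnK binn mul1n.
rewrite /cross_coef !E /slope /slope_part /boundary_term -/T !expnS.
set x4 := (X in 8 * X = 4 * _) in A4; set x5 := (X in 8 * X = 2 * _) in A5.
set y4 := (X in 8 * X = P * bin_pred _.+1 _) in B4; set y5 := (X in 8 * X = _) in B5.
have -> : (match j with
      | 0%N => 0
      | i.+1 => 8 * (lucas_coef 2 8 k i)%:Z + 48 * (lucas_coef 2 8 k.-1 i)%:Z
          - 8 * (lucas_coef 1 8 k i)%:Z - 40 * (lucas_coef 1 8 k.-1 i)%:Z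
      end = 8 * x4%:Z + 48 * x5%:Z - 8 * y4%:Z - 40 * y5%:Z :> int)%R.
  by rewrite /x4 /x5 /y4 /y5; case: (j) => [|i]; lia.
have -> : (k == j.+2.*2) = (b == 4) by rewrite /k; lia.
have -> : (k.-1 == j.+2.*2) = (b == 5) by rewrite /k; lia.
have -> : (k.-1 == j.+1.*2) = (b == 3) by rewrite /k; lia.
have -> : (k == j.+1.*2) = (b == 2) by rewrite /k; lia.
have -> : (k.-1 == j.*2) = (b == 1) by rewrite /k; lia.
have -> : ((j == 0%N)%:R * 2 = (if j is 0%N then 2 else 0) :> int)%R by case: (j).
move: x4 x5 y4 y5 A4 A5 B4 B5 A1 A2 A3 B0 B0' B1 B2 B3.
move: (lucas_coef 2 8 _ _) (lucas_coef 2 8 _ _) (lucas_coef 2 8 _ _).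
do 5!move: (lucas_coef 1 8 _ _).
move: P T 'C(_, _) 'C(_, _) 'C(_, _) 'C(_, _) 'C(_, _) (bin_pred _ _) (bin_pred _ _) (4 ^ j).
clear E; move=> P T c1 c2 c3 c4 c5 c6 c7 F *.
by case: (b) => [|[|[|[|[|[|b']]]]]]; case: (j) => [|j']; lia.
Qed.

End Steps.

Section Monotonicity.
Local Open Scope Z_scope.

(** At j = 0 mere positivity would not do: the slope must outweigh the -2 in [boundary_term]. *)
Lemma slope0_ge3 b : (4 <= b)%N -> 3 <= slope b 0.
Proof.
move=> le4b; rewrite /slope /slope_part addn0 !bin0 !bin1 /bin_pred.
have := expn2_ge b; move: 'C(_, _) (2 ^ b)%N => x T leT.
have : 0 <= Z.of_nat T * Z.of_nat b.-1 by apply: Z.mul_nonneg_nonneg; lia.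
lia.
Qed.

Lemma step_pos b j : (7 <= b + j.*2)%N -> (j <= b)%N ->
  0 < Z.of_nat (8 ^ j)%N * slope b j + boundary_term b j.
Proof.
move=> ge7 lejb; have [le4b|ltb4] := leqP 4 b.
  have [->|j0] := posnP j.
    have := slope0_ge3 le4b; rewrite /boundary_term expn0.
    by case: b le4b {lejb ge7} => [|[|[|[|[|[|b]]]]]] // _; lia.
  have := slope_inc le4b lejb; have : 0 < Z.of_nat (8 ^ j)%N by have := expn_gt0 8 j; lia.
  have : 0 <= boundary_term b j.
    by rewrite /boundary_term; case: j j0 {lejb ge7} => // j _;
       case: b le4b => [|[|[|[|[|[|b]]]]]] // _; lia.
  nia.
(* If j <= b <= 3, then b + 2j >= 7 leaves only these two pairs. *)
have : (b = 3 /\ j = 2 \/ b = 3 /\ j = 3)%N by lia.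
by case=> [[-> ->]|[-> ->]]; vm_compute.
Qed.

(** The slope is a negative integer and 8 ^ j = 2 ^ j * 4 ^ j, so a boundary term t * 4 ^ j is
    outweighed as soon as t < 2 ^ j. For t = 12 this holds from j = 4 on and for t = 64 from j = 7
    on; the few smaller j are evaluated. *)
Lemma step_neg b j : (7 <= b + j.*2)%N -> (b < j)%N ->
  Z.of_nat (8 ^ j)%N * slope b j + boundary_term b j < 0.
Proof.
move=> ge7 ltbj; have neg : slope b j <= -1.
  by have := slope_dec ltbj; lia.
have P8 : (8 ^ j = 2 ^ j * 4 ^ j)%N by rewrite -expnMn.
have F0 : 0 < Z.of_nat (4 ^ j)%N by have := expn_gt0 4 j; lia.
have large t : (t < 2 ^ j)%N ->
    Z.of_nat (8 ^ j)%N * slope b j + Z.of_nat t * Z.of_nat (4 ^ j)%N < 0.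
  move=> ltt; rewrite P8 Z_of_natM; move: (Z.of_nat (4 ^ j)%N) F0 => F F0.
  have : Z.of_nat t + 1 <= Z.of_nat (2 ^ j)%N by lia.
  have : 0 <= Z.of_nat t by lia.
  move: (Z.of_nat (2 ^ j)%N) (Z.of_nat t) (slope b j) neg => Q u S neg u0 lequ.
  have : 0 <= Q * F * (-1 - S) by apply: Z.mul_nonneg_nonneg; nia.
  have : 0 < F * (Q - u) by apply: Z.mul_pos_pos; lia.
  lia.
have bnd : boundary_term b j <=
    match b with 1%N => 12 | 4%N | 5%N => 64 | _ => 0 end * Z.of_nat (4 ^ j)%N.
  by rewrite /boundary_term; case: (j) => [|j']; case: (b) => [|[|[|[|[|[|b']]]]]]; lia.
have pow2 i : (i <= j)%N -> (2 ^ i <= 2 ^ j)%N by apply: leq_pexp2l.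
case: b ge7 ltbj neg large bnd => [|[|[|[|[|[|b]]]]]] ge7 ltbj neg large bnd.
- by have := large 0%N (expn_gt0 2 j); lia.
- have [ej|ge4] : j = 3%N \/ (4 <= j)%N by lia.
    by rewrite ej; vm_compute.
  by have := large 12%N (leq_trans (isT : 12 < 2 ^ 4)%N (pow2 4%N ge4)); lia.
- by have := large 0%N (expn_gt0 2 j); lia.
- by have := large 0%N (expn_gt0 2 j); lia.
- have [ej|[ej|ge7']] : j = 5%N \/ j = 6%N \/ (7 <= j)%N by lia.
  + by rewrite ej; vm_compute.
  + by rewrite ej; vm_compute.
  by have := large 64%N (leq_trans (isT : 64 < 2 ^ 7)%N (pow2 7%N ge7')); lia.
- have [ej|ge7'] : j = 6%N \/ (7 <= j)%N by lia.
    by rewrite ej; vm_compute.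
  by have := large 64%N (leq_trans (isT : 64 < 2 ^ 7)%N (pow2 7%N ge7')); lia.
by have := large 0%N (expn_gt0 2 j); lia.
Qed.

End Monotonicity.

(** * The peak *)

Lemma geq_bigmin (I : eqType) (r : seq I) (P : pred I) (F : I -> nat) x i :
  i \in r -> P i -> \big[minn/x]_(k <- r | P k) F k <= F i.
Proof.
elim: r => // k r IH; rewrite inE big_cons => /orP[/eqP <- Pi|ir Pi].
  by rewrite Pi geq_minl.
by case: ifP => _; rewrite ?IH // geq_min IH ?orbT.
Qed.

(** The minimum and maximum genus need not be computed: the inequalities range over all genera, and
    g p > 0 alone places p between the two. *)
Lemma is_peak_genus (G : multigraph) (p : nat) :
  let g := embeddings_of_genus G in
  (forall i, i.+1 < p -> g i <= g i.+1) -> (0 < p -> g p.-1 < g p) ->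
  g p.+1 < g p -> (forall i, p < i -> g i.+1 <= g i) ->
  is_peak g (min_genus G) (max_genus G) p.
Proof.
move=> g inc inc_last dec_first dec; have gp : 0 < g p by apply: leq_ltn_trans dec_first.
have [s] : exists s, s \in [set s in rotation_systems G | genus s == p].
  by apply/set0Pn; rewrite -card_gt0.
rewrite inE => /andP[rot /eqP gs].
have leqp : min_genus G <= p by rewrite -gs; apply: geq_bigmin; rewrite ?mem_index_enum.
have lepM : p <= max_genus G by rewrite -gs; apply: (leq_bigmax_cond _ rot).
rewrite /is_peak /unimodal_with_plateau leqp leqnn lepM; split=> //; split=> //.
- by move=> i _; apply: inc.
- by move=> ltqp; apply: inc_last; lia.
- by move=> i /andP[lepi leip]; congr g; lia.
- by move=> i ltpi _; apply: dec.
Qed.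

Section CrossPeak.
Local Open Scope ring_scope.

(** Genus 0 lies outside the range of [cross_coef] and has its own hypothesis: a comparison if p =
    1, and otherwise k > 1, which makes its number 0. *)
Lemma is_peak_cross k p : (0 < k)%N -> (0 < p)%N ->
    (if p == 1%N then (cross_poly k)`_0 < cross_coef k 0 else (1 < k)%N) ->
    (forall j, (j.+1 < p)%N -> cross_coef k j < cross_coef k j.+1) ->
    cross_coef k p < cross_coef k p.-1 ->
    (forall j, (p <= j)%N -> cross_coef k j.+1 <= cross_coef k j) ->
  is_peak (embeddings_of_genus (cross k.+1)) (min_genus (cross k.+1))
    (max_genus (cross k.+1)) p.
Proof.
case: p => // p k0 _ first inc last dec.
have gE j : (embeddings_of_genus (cross k.+1) j.+1)%:Z = cross_coef k j.
  by rewrite embeddings_of_genus_cross cross_coefE.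
apply: is_peak_genus => [[|i] ltip|_||[|i] ltpi] //.
- move: first; rewrite ifF; last by lia.
  by move=> k1; rewrite -lez_nat embeddings_of_genus_cross coef0_cross_poly.
- by rewrite -lez_nat !gE ltW // inc //; lia.
- case: p first inc {last dec} => [|p] first inc /=; rewrite -ltz_nat gE.
    by rewrite embeddings_of_genus_cross.
  by rewrite gE; apply: inc.
- by rewrite -ltz_nat !gE.
- by rewrite -lez_nat !gE; apply: dec.
Qed.

Lemma is_peak_cross_large n : (8 <= n)%N ->
  is_peak (embeddings_of_genus (cross n)) (min_genus (cross n)) (max_genus (cross n))
    ((n + 2) %/ 3 + 1).
Proof.
case: n => // k le7k; set p := ((k.+1 + 2) %/ 3 + 1)%N.
have inc j : (3 * j <= k)%N -> cross_coef k j < cross_coef k j.+1.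
  move=> le3jk; have [b ek] : exists b, k = (b + j.*2)%N by exists (k - j.*2)%N; lia.
  have lt1 : (1 < b + j)%N by lia.
  have := cross_coef_step lt1; have := @step_pos b j; rewrite -ek => /(_ ltac:(lia) ltac:(lia)).
  lia.
have dec j : (k < 3 * j)%N -> (j.*2 <= k)%N -> cross_coef k j.+1 < cross_coef k j.
  move=> ltk3j le2jk; have [b ek] : exists b, k = (b + j.*2)%N by exists (k - j.*2)%N; lia.
  have lt1 : (1 < b + j)%N by lia.
  have := cross_coef_step lt1; have := @step_neg b j; rewrite -ek => /(_ ltac:(lia) ltac:(lia)).
  lia.
(* That is, p - 2 = [k / 3] is the last j with 3j <= k; the step at that j leads from genus p - 1 to
   genus p. *)
have pE : (3 * p <= k + 6 < 3 * p + 3)%N by rewrite /p; lia.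
apply: is_peak_cross; try by lia.
- by rewrite ifF; lia.
- by move=> j ltjp; apply: inc; lia.
- have -> : p = (p.-1).+1 by lia.
  by apply: dec => /=; lia.
- move=> j lepj; have [le2jk|ltk2j] := leqP j.*2 k.
    by apply/ltW/dec; lia.
  have -> : cross_coef k j.+1 = 0 by apply: cross_coef_eq0; lia.
  have -> : j = j.-1.+1 by lia.
  by rewrite -cross_coefE -?embeddings_of_genus_cross //; lia.
Qed.

Lemma cross_poly0 : cross_poly 0 = 4 + 12 * 'X.
Proof.
rewrite /cross_poly /= -(big_allpairs_dep (h := fun x y => closing_genus (start_state x) y)
  (r1 := bit_pairs) (r2 := fun=> bit_pairs) (F := fun i => 'X^i : {poly int})).
have /(perm_big _) -> : perm_eq
    [seq closing_genus (start_state x) y | x <- bit_pairs, y <- bit_pairs]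
    (nseq 4 0 ++ nseq 12 1)%N by vm_compute.
by rewrite big_cat !big_nseq /=; ring.
Qed.

(** R_1 has no rung after the first and so escapes the closed form; its distribution 4, 12 is read
    off from [cross_poly0]. *)
Lemma is_peak_cross1 :
  is_peak (embeddings_of_genus (cross 1)) (min_genus (cross 1)) (max_genus (cross 1)) 1.
Proof.
have gE i : embeddings_of_genus (cross 1) i = ((i == 0) * 4 + (i == 1) * 12)%N.
  have := embeddings_of_genus_cross 0 i.
  have -> : cross_poly 0 = 4%:R * 1 + 12%:R * 1 * 'X by rewrite cross_poly0; ring.
  rewrite coefD coefMX !mulr_natl !coefMn !coef1.
  by case: i => [|[|i]] /=; lia.
by apply: is_peak_genus => [[|i]|_||[|[|i]]] //; rewrite !gE.
Qed.

Lemma is_peak_cross_small k p : (k, p) \in [:: (1, 1); (2, 2); (3, 2); (4, 3); (5, 3); (6, 3)]%N ->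
  is_peak (embeddings_of_genus (cross k.+1)) (min_genus (cross k.+1))
    (max_genus (cross k.+1)) p.
Proof.
have compute q l : (0 < l)%N -> (l < 7)%N -> (0 < q)%N ->
    (if q == 1%N then (cross_poly l)`_0 < cross_coef l 0 else (1 < l)%N) ->
    all (fun j => cross_coef l j < cross_coef l j.+1) (iota 0 q.-1) ->
    cross_coef l q < cross_coef l q.-1 ->
    all (fun j => cross_coef l j.+1 <= cross_coef l j) (iota q (6 - q)) ->
  is_peak (embeddings_of_genus (cross l.+1)) (min_genus (cross l.+1))
    (max_genus (cross l.+1)) q.
  move=> l0 l7 q0 first /allP inc last /allP dec; apply: is_peak_cross => // j.
    by move=> ltjq; apply: inc; rewrite mem_iota; lia.
  (* As l < 7, both numbers are 0 from j = 6 on, so the finite list of comparisons suffices. *)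
  move=> leqj; have [lt6j|le6j] := ltnP j 6.
    by apply: dec; rewrite mem_iota; lia.
  by case: j leqj le6j => // j leqj le6j; rewrite !cross_coef_eq0 //; lia.
rewrite !inE !xpair_eqE => h.
have [[-> ->]|[[-> ->]|[[-> ->]|[[-> ->]|[[-> ->]|[-> ->]]]]]] :
  (k = 1 /\ p = 1 \/ k = 2 /\ p = 2 \/ k = 3 /\ p = 2 \/ k = 4 /\ p = 3
   \/ k = 5 /\ p = 3 \/ k = 6 /\ p = 3)%N by lia.
- apply: compute; [by [] | by [] | by [] | | by vm_compute | by vm_compute | by vm_compute].
  have -> : (cross_poly 1)`_0 = 4.
    by rewrite cross_polyE /= !(mulr0, mulr1, coefD, coefN, coefMX, coefMn, coef1, coef0).
  by vm_compute.
- by apply: compute; vm_compute.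
- by apply: compute; vm_compute.
- by apply: compute; vm_compute.
- by apply: compute; vm_compute.
- by apply: compute; vm_compute.
Qed.

End CrossPeak.

Unset Implicit Arguments.

Theorem theorem4p8 (n : nat) (hn : 1 <= n) :
  let g := embeddings_of_genus (cross n) in
  let q := min_genus (cross n) in
  let M := max_genus (cross n) in
  unimodal g q M /\ is_peak g q M (cross_peak n).
Proof.
move=> g q M; suff peak : is_peak g q M (cross_peak n).
  by split=> //; exists (cross_peak n), (cross_peak n).
rewrite /cross_peak /g /q /M; have [le8n|lt8n] := leqP 8 n.
  by rewrite ifF ?ifF; [exact: is_peak_cross_large | lia | lia].
case: n hn lt8n {g q M} => [|[|[|[|[|[|[|[|n]]]]]]]] // _ _.
- exact: is_peak_cross1.
- exact: (@is_peak_cross_small 1 1).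
- exact: (@is_peak_cross_small 2 2).
- exact: (@is_peak_cross_small 3 2).
- exact: (@is_peak_cross_small 4 3).
- exact: (@is_peak_cross_small 5 3).
- exact: (@is_peak_cross_small 6 3).
Qed.
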